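(* Let $(M=G/H,F)$ be a homogeneous Finsler space with origin $p$ and reductive decomposition $\mathfrak g=\mathfrak m\oplus\mathfrak h$, and let $X\in\mathfrak g$ be a geodesic vector with $X_{\mathfrak m}\neq0$. Then $\mathbf S(X_{\mathfrak m})=0$, where $\mathbf S$ is the $\mathbf S$-curvature of $F$ for the Busemann volume form.
   Context: A Finsler metric on a smooth manifold $M$ is a continuous function $F:TM\to[0,\infty)$, smooth on $TM\setminus\{0\}$, positively homogeneous of degree one ($F(tu)=tF(u)$ for $t\ge 0$; not necessarily reversible), such that for every $y\in T_xM\setminus\{0\}$ the symmetric bilinear form $g_y(u,v)=\frac12\frac{\partial^2}{\partial s\partial t}F^2(x,y+su+tv)\big|_{s=t=0}$ on $T_xM$ is positive definite. Geodesics are the Finslerian (constant speed) geodesics, i.e. curves $\sigma$ with velocity $T=\dot\sigma$ satisfying $D_TT=0$ with reference vector $T$ for the Chern connection. $(M,F)$ is a connected Finsler manifold on which a connected Lie group $G$ of isometries acts transitively; $H$ is the isotropy group of a fixed point $p$, and $M$ is identified with $G/H$. $\mathfrak g,\mathfrak h$ are the Lie algebras of $G,H$, and $\mathfrak g=\mathfrak m\oplus\mathfrak h$ is a fixed reductive decomposition ($\mathrm{Ad}(H)\mathfrak m\subset\mathfrak m$). The subscript $\mathfrak m$ denotes projection onto $\mathfrak m$ along $\mathfrak h$; $\mathfrak m$ is identified with $T_pM$ via the differential of $G\to G/H$, so $X_{\mathfrak m}$ corresponds to $\frac{d}{dt}\big|_{0}\exp(tX)(p)\in T_pM$. A vector $X\in\mathfrak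 g\setminus\{0\}$ is a geodesic vector if $t\mapsto\exp(tX)(p)$ is a constant speed geodesic of $(M,F)$. $\mathbf S$-curvature: let $n=\dim M$, $\{e_i\}$ a basis of $T_xM$ with dual basis $\{\omega^i\}$. The Busemann volume form at $x$ is $\sigma(x)\,\omega^1\wedge\dots\wedge\omega^n$ with $\sigma(x)=\mathrm{Vol}(B^n)/\mathrm{Vol}\{(y^i)\in\mathbb R^n: F(y^ie_i)<1\}$, where $\mathrm{Vol}$ is Euclidean volume and $B^n$ the unit ball of $\mathbb R^n$. The distortion is $\tau(x,y)=\ln\big[\sqrt{\det(g_y(e_i,e_j))}/\sigma(x)\big]$ for $y\in T_xM\setminus\{0\}$ (independent of the basis). Then $\mathbf S(x,y)=\frac{d}{dt}\big[\tau(c(t),\dot c(t))\big]_{t=0}$, where $c$ is the geodesic with $c(0)=x$, $\dot c(0)=y$. *)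

(* Defs.v *)
From HB Require Import structures.
From mathcomp Require Import all_boot all_order all_algebra.
From mathcomp Require Import all_classical all_reals all_analysis.

Set Implicit Arguments.
Unset Strict Implicit.
Unset Printing Implicit Defensive.

Import Order.TTheory GRing.Theory Num.Theory.
Import numFieldNormedType.Exports.

Local Open Scope classical_set_scope.
Local Open Scope ring_scope.

Section Smoothness.
Context {R : realType} {V W : normedModType R}.

(* For V finite-dimensional and U open this is the usual class C^k(U). *)
Fixpoint Ck (k : nat) (U : set V) (f : V -> W) : Prop :=
  if k is k'.+1 then
    (forall x, U x -> differentiable f x) /\
    (forall v : V, Ck k' U (fun x => 'D_v f x))
  else forall x, U x -> {for x, continuous f}.

Definition smooth_on (U : set V) (f : V -> W) : Prop := forall k, Ck k U f.

End Smoothness.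

(* [cinv] is only meaningful on the image [cimg] of the chart. *)
Record chart (R : realType) (n : nat) (M : topologicalType) := Chart {
  cdom : set M ;
  cmap :> M -> 'rV[R]_n ;
  cinv : 'rV[R]_n -> M ;
  cdom_open : open cdom ;
  cimg_open : open (cmap @` cdom) ;
  cmapK : forall x, cdom x -> cinv (cmap x) = x ;
  cmap_continuous : forall x, cdom x -> {for x, continuous cmap} ;
  cinv_continuous : forall u, (cmap @` cdom) u -> {for u, continuous cinv} }.

Definition cimg {R : realType} {n : nat} {M : topologicalType}
    (phi : chart R n M) : set 'rV[R]_n := phi @` cdom phi.

(* [chart_at] selects one chart around each point.  A tangent vector at x is  *)
(* represented by its components in the chart [chart_at x], so that T_x M is  *)
(* the type 'rV[R]_n for every x.                                             *)
Record smooth_manifold (R : realType) (n : nat) (M : topologicalType) :=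
  SmoothManifold {
  atlas : set (chart R n M) ;
  chart_at : M -> chart R n M ;
  chart_at_atlas : forall x, atlas (chart_at x) ;
  mem_chart_at : forall x, cdom (chart_at x) x ;
  chart_compat : forall phi psi, atlas phi -> atlas psi ->
    smooth_on (phi @` (cdom phi `&` cdom psi)) (fun u => psi (cinv phi u)) ;
  manifold_hausdorff : hausdorff_space M ;
  manifold_second_countable : @second_countable M }.

Section SmoothMaps.
Context {R : realType}.

Definition smooth_map {n1 n2} {M1 M2 : topologicalType}
    (A1 : smooth_manifold R n1 M1) (A2 : smooth_manifold R n2 M2)
    (f : M1 -> M2) : Prop :=
  continuous f /\
  forall phi psi, atlas A1 phi -> atlas A2 psi ->
    smooth_on (phi @` (cdom phi `&` f @^-1` cdom psi))
              (fun u => psi (f (cinv phi u))).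

(* Smoothness on the product manifold M1 x M2, tested on product charts. *)
Definition smooth_map2 {n1 n2 n3} {M1 M2 M3 : topologicalType}
    (A1 : smooth_manifold R n1 M1) (A2 : smooth_manifold R n2 M2)
    (A3 : smooth_manifold R n3 M3) (f : M1 -> M2 -> M3) : Prop :=
  continuous (fun z : M1 * M2 => f z.1 z.2) /\
  forall phi1 phi2 psi, atlas A1 phi1 -> atlas A2 phi2 -> atlas A3 psi ->
    smooth_on
      [set w : 'rV[R]_n1 * 'rV[R]_n2 | [/\ cimg phi1 w.1, cimg phi2 w.2 &
         cdom psi (f (cinv phi1 w.1) (cinv phi2 w.2))]]
      (fun w => psi (f (cinv phi1 w.1) (cinv phi2 w.2))).

Definition smooth_curve {n} {M : topologicalType} (A : smooth_manifold R n M)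
    (I : set R) (c : R -> M) : Prop :=
  (forall t, I t -> {for t, continuous c}) /\
  forall phi, atlas A phi ->
    smooth_on (I `&` c @^-1` cdom phi) (fun t : R => phi (c t)).

Definition velocity {n} {M : topologicalType} (A : smooth_manifold R n M)
    (c : R -> M) (t : R) : 'rV[R]_n :=
  derive1 (fun s : R => chart_at A (c t) (c s)) t.

Definition tangent_map {n1 n2} {M1 M2 : topologicalType}
    (A1 : smooth_manifold R n1 M1) (A2 : smooth_manifold R n2 M2)
    (f : M1 -> M2) (x : M1) : 'rV[R]_n1 -> 'rV[R]_n2 :=
  'd (fun u => chart_at A2 (f x) (f (cinv (chart_at A1 x) u)))
     (chart_at A1 x x).

End SmoothMaps.

Section Finsler.
Context {R : realType} {n : nat}.

Definition base_vector (i : 'I_n) : 'rV[R]_n := delta_mx 0 i.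

(* g_y(u, v) for the norm f on a tangent space. *)
Definition fundamental_form (f : 'rV[R]_n -> R) (y u v : 'rV[R]_n) : R :=
  2^-1 * derive1 (fun s : R =>
    derive1 (fun t : R => f (y + s *: u + t *: v) ^+ 2) 0) 0.

Definition fundamental_matrix (f : 'rV[R]_n -> R) (y : 'rV[R]_n) : 'M[R]_n :=
  \matrix_(i, j) fundamental_form f y (base_vector i) (base_vector j).

Section Metric.
Context {M : topologicalType} (A : smooth_manifold R n M).

(* Components in [chart_at] of the tangent vector at [cinv phi u] whose       *)
(* components in the chart phi are v.                                         *)
Definition chart_vector (phi : chart R n M) (u v : 'rV[R]_n) : 'rV[R]_n :=
  'd (fun u' => chart_at A (cinv phi u) (cinv phi u')) u v.

(* F in the coordinates (x^i, y^i) of TM induced by the chart phi. *)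
Definition local_metric (F : M -> 'rV[R]_n -> R) (phi : chart R n M)
    (x y : 'rV[R]_n) : R := F (cinv phi x) (chart_vector phi x y).

Record finsler_metric (F : M -> 'rV[R]_n -> R) : Prop := FinslerMetric {
  finsler_ge0 : forall x y, 0 <= F x y ;
  finsler_continuous : forall phi, atlas A phi ->
    forall w : 'rV[R]_n * 'rV[R]_n, cimg phi w.1 ->
    {for w, continuous (fun w => local_metric F phi w.1 w.2)} ;
  finsler_smooth : forall phi, atlas A phi ->
    smooth_on (W := R^o)
      [set w : 'rV[R]_n * 'rV[R]_n | cimg phi w.1 /\ w.2 != 0]
      (fun w => local_metric F phi w.1 w.2) ;
  finsler_homogeneous : forall x y (t : R), 0 <= t -> F x (t *: y) = t * F x y ;
  finsler_convex : forall x y u, y != 0 -> u != 0 ->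
    0 < fundamental_form (F x) y u u }.

(* Chern connection in the coordinates (x^i, y^i) of a chart, where L is the  *)
(* local expression of F.  Formulas as in Bao-Chern-Shen, An Introduction to  *)
(* Riemann-Finsler Geometry, Chapter 2.                                       *)
Section ChernConnection.

Definition partial_x (k : 'I_n) (f : 'rV[R]_n -> 'rV[R]_n -> R)
    (x y : 'rV[R]_n) : R :=
  'D_(base_vector k) (fun x' => f x' y : R^o) x.

Definition partial_y (k : 'I_n) (f : 'rV[R]_n -> 'rV[R]_n -> R)
    (x y : 'rV[R]_n) : R :=
  'D_(base_vector k) (fun y' => f x y' : R^o) y.

Variable L : 'rV[R]_n -> 'rV[R]_n -> R.

Definition metric_coef (i j : 'I_n) (x y : 'rV[R]_n) : R :=
  fundamental_matrix (L x) y i j.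

Definition metric_coef_inv (i j : 'I_n) (x y : 'rV[R]_n) : R :=
  invmx (fundamental_matrix (L x) y) i j.

(* gamma^i_{jk} *)
Definition formal_christoffel (i j k : 'I_n) (x y : 'rV[R]_n) : R :=
  2^-1 * \sum_(s < n) metric_coef_inv i s x y *
    (partial_x k (metric_coef s j) x y - partial_x s (metric_coef j k) x y
     + partial_x j (metric_coef k s) x y).

(* C^i_{jk} *)
Definition cartan_coef (i j k : 'I_n) (x y : 'rV[R]_n) : R :=
  2^-1 * \sum_(s < n) metric_coef_inv i s x y * partial_y k (metric_coef s j) x y.

(* N^i_j *)
Definition nonlinear_coef (i j : 'I_n) (x y : 'rV[R]_n) : R :=
  \sum_(k < n) formal_christoffel i j k x y * y 0 k
  - \sum_(k < n) \sum_(r < n) \sum_(s < n)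
      cartan_coef i j k x y * formal_christoffel k r s x y * y 0 r * y 0 s.

(* delta/delta x^k = d/dx^k - N^s_k d/dy^s *)
Definition horizontal_der (k : 'I_n) (f : 'rV[R]_n -> 'rV[R]_n -> R)
    (x y : 'rV[R]_n) : R :=
  partial_x k f x y - \sum_(s < n) nonlinear_coef s k x y * partial_y s f x y.

(* Gamma^i_{jk} *)
Definition chern_coef (i j k : 'I_n) (x y : 'rV[R]_n) : R :=
  2^-1 * \sum_(s < n) metric_coef_inv i s x y *
    (horizontal_der k (metric_coef s j) x y
     - horizontal_der s (metric_coef j k) x y
     + horizontal_der j (metric_coef k s) x y).

End ChernConnection.

(* Component i, in the chart phi, of D_T T with reference vector T, where T   *)
(* is the velocity of c.                                                      *)
Definition covariant_acceleration (F : M -> 'rV[R]_n -> R) (phi : chart R n M)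
    (c : R -> M) (t : R) (i : 'I_n) : R :=
  let T := derive1 (fun s : R => phi (c s)) in
  derive1 T t 0 i
  + \sum_(j < n) \sum_(k < n)
      T t 0 j * T t 0 k * chern_coef (local_metric F phi) i j k (phi (c t)) (T t).

(* The reference vector T has to be nonzero, so constant curves are excluded. *)
Definition geodesic (F : M -> 'rV[R]_n -> R) (I : set R) (c : R -> M) : Prop :=
  smooth_curve A I c /\
  forall t, I t -> velocity A c t != 0 /\
    forall phi, atlas A phi -> cdom phi (c t) ->
      forall i, covariant_acceleration F phi c t i = 0.

End Metric.
End Finsler.

(* n-dimensional Lebesgue measure of a Borel set, by iterating the formula    *)
(* (m1 \x m2) B = \int[m1]_x m2 (xsection B x) that defines product measures. *)
Fixpoint euclidean_volume {R : realType} (n : nat) :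
    set 'rV[R]_n -> \bar R :=
  match n with
  | 0 => fun B => (\1_B (0 : 'rV[R]_0) : R)%:E
  | n'.+1 => fun B => (\int[lebesgue_measure]_(x in [set: R])
      euclidean_volume [set v : 'rV[R]_n' |
        B (row_mx (const_mx x : 'rV[R]_1) v)])%E
  end.

Section SCurvature.
Context {R : realType} {n : nat} {M : topologicalType}.
Variables (A : smooth_manifold R n M) (F : M -> 'rV[R]_n -> R).

(* Density of the Busemann volume form at x, and distortion, with respect to  *)
(* the coordinate basis of T_x M given by [chart_at x]; the distortion does   *)
(* not depend on the basis.                                                   *)
Definition busemann_density (x : M) : R :=
  fine (euclidean_volume [set v : 'rV[R]_n | \sum_(i < n) v 0 i ^+ 2 < 1]) /
  fine (euclidean_volume [set v : 'rV[R]_n | F x v < 1]).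

Definition distortion (x : M) (y : 'rV[R]_n) : R :=
  ln (Num.sqrt (\det (fundamental_matrix (F x) y)) / busemann_density x).

(* S(x, y) = s.  The geodesic with initial velocity y is unique only as a     *)
(* germ, hence the quantification over all its representatives.               *)
Definition S_curvature_is (x : M) (y : 'rV[R]_n) (s : R) : Prop :=
  let geodesic_from (c : R -> M) :=
    [/\ exists2 eps : R, 0 < eps & geodesic A F `]- eps, eps[ c,
        c 0 = x & velocity A c 0 = y] in
  (exists c, geodesic_from c) /\
  forall c, geodesic_from c ->
    is_derive (0 : R^o) 1 (fun t : R^o => distortion (c t) (velocity A c t) : R^o) s.

End SCurvature.

#[short(type="topGroupType")]
HB.structure Definition TopGroup := {G of Topological G & Group G}.

Section Lie.
Context {R : realType} {k : nat} {G : topGroupType}.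
Variable AG : smooth_manifold R k G.

Definition lie_group : Prop :=
  smooth_map2 AG AG AG (fun g h => g * h)%g /\
  smooth_map AG AG (fun g => g^-1)%g.

(* gamma is t |-> exp(t X), where X is in the Lie algebra T_1 G. *)
Definition exp_curve (X : 'rV[R]_k) (gamma : R -> G) : Prop :=
  [/\ smooth_curve AG setT gamma,
      gamma 0 = 1%g,
      forall s t, gamma (s + t) = (gamma s * gamma t)%g &
      velocity AG gamma 0 = X].

Definition Ad (g : G) (X : 'rV[R]_k) : 'rV[R]_k :=
  tangent_map AG AG (fun h => g * h * g^-1)%g 1%g X.

(* h is the Lie algebra of the closed subgroup H. *)
Definition lie_algebra_of (H : set G) (h : {vspace 'rV[R]_k}) : Prop :=
  forall X, X \in h <->
    exists2 gamma, exp_curve X gamma & forall t, H (gamma t).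

Definition reductive_decomposition (H : set G) (m h : {vspace 'rV[R]_k}) :
    Prop :=
  [/\ (m + h = fullv)%VS, (m :&: h = 0)%VS &
      forall g X, H g -> X \in m -> Ad g X \in m].

Section Action.
Context {n : nat} {M : topologicalType}.
Variables (AM : smooth_manifold R n M) (F : M -> 'rV[R]_n -> R).
Variables (act : G -> M -> M) (p : M).

Record smooth_action : Prop := SmoothAction {
  act1 : forall x, act 1%g x = x ;
  actM : forall g h x, act (g * h)%g x = act g (act h x) ;
  act_smooth : smooth_map2 AG AM AM act }.

Definition transitive_action : Prop := forall x y, exists g, act g x = y.

Definition isometric_action : Prop :=
  forall g x v, F (act g x) (tangent_map AM AM (act g) x v) = F x v.

Definition isotropy : set G := [set g | act g p = p].

(* Differential at 1 of G -> M, g |-> g p; on a complement of the isotropy    *)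
(* algebra it is the identification with T_p M.                               *)
Definition orbit_differential (X : 'rV[R]_k) : 'rV[R]_n :=
  tangent_map AG AM (fun g => act g p) 1%g X.

Definition geodesic_vector (X : 'rV[R]_k) : Prop :=
  X != 0 /\
  exists2 gamma, exp_curve X gamma &
    geodesic AM F setT (fun t => act (gamma t) p).

End Action.
End Lie.

(* Main.v *)
From HB Require Import structures.
Require Import Defs.
From mathcomp Require Import all_boot all_order all_algebra.
From mathcomp Require Import all_classical all_reals all_analysis.
From mathcomp Require Import measurable_realfun ring lra.

Set Implicit Arguments.
Unset Strict Implicit.
Unset Printing Implicit Defensive.

Import Order.TTheory GRing.Theory Num.Theory.
Import numFieldNormedType.Exports.

Local Open Scope classical_set_scope.
Local Open Scope ring_scope.

(* The one-parameter group gamma of X acts by isometries and translates the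
   geodesic c(t) = gamma(t) p along itself: the differential of gamma(t) maps
   c'(0) to c'(t) and F at p to F at c(t).  The distortion is an isometry
   invariant, because under a linear change of coordinates J both the square
   root of det g_y and the inverse volume of the unit ball are multiplied by
   |det J|; hence it is constant along c.  Any other geodesic with the same
   initial velocity agrees with c near 0: the coefficients of the Chern
   connection are smooth on the slit tangent bundle, so that in a chart the
   geodesic equation has locally Lipschitz coefficients.  Finally c'(0) is the
   vector X_m, since the h-component of X generates curves fixing p. *)

(** * Linear change of variables for the Euclidean volume *)

(** [S_curvature_is] quantifies over every geodesic with the given initial data, so exhibiting the
    orbit [c] settles existence but not the value; this is what makes a uniqueness theorem
    unavoidable. Uniqueness alone suffices, hence a local Lipschitz bound and a mean value estimate
    instead of a fixed-point construction. The bound is available because [geodesic] demands nonzero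
    velocity, which keeps the pair of position and velocity where F is smooth. The other obstacle is
    the volume. [euclidean_volume] is a bare iterated integral in a fixed order of the coordinates,
    whereas a Jacobian mixes them all. The determinant rule is obtained by Gaussian elimination:
    each triangular factor acts by an affine map either on lines parallel to the first axis or on
    slices orthogonal to it, and Tonelli's theorem allows either to be integrated first.
    Translations are carried through the induction, and openness of the unit ball of F supplies the
    measurability that Tonelli requires. *)

Section LebesgueAffine.
Context {R : realType}.
Local Notation leb := (@lebesgue_measure R).

Lemma lebesgue_measure_affine (a b : R) (A : set R) : a != 0 -> measurable A ->
  leb [set x | A (a * x + b)] = (`|a|^-1%:E * leb A)%E.
Proof.
move=> a0 mA.
pose f := (fun x : measurableTypeR R => a * x + b : measurableTypeR R).
have mf : measurable_fun setT f.
  by apply: measurable_funD; [exact: measurable_funM|exact: measurable_cst].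
have aP : 0 <= `|a| by [].
(* Uniqueness of Lebesgue measure: [|a|] times the pushforward along x |-> a x + b gives every ]c,
   d] its length. For a < 0 the half-open side flips, which leaves the length unchanged. *)
pose m1 : {measure set (measurableTypeR R) -> \bar R} :=
  measure_function_pushforward__canonical__measure_function_Measure leb mf.
suff -> : leb A = mscale (NngNum aP) m1 A.
  by rewrite /mscale muleA -EFinM mulVf ?normr_eq0// mul1e.
apply: lebesgue_measure_unique => // _ [[c d] /= _ <-].
rewrite /mscale /m1 /= /pushforward /=.
have [a_lt0|a_gt0|ae] := ltgtP a 0; last by rewrite ae eqxx in a0.
- have -> : f @^-1` `]c, d] = `[(d - b) / a, (c - b) / a[%classic.
    apply/seteqP; split=> x /=; rewrite !in_itv/= /f.
      by rewrite ler_ndivrMr// ltr_ndivlMr// mulrC lerBrDr ltrBlDr => /andP[-> ->].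
    by rewrite ler_ndivrMr// ltr_ndivlMr// mulrC lerBrDr ltrBlDr => /andP[-> ->].
  rewrite !lebesgue_measure_itv/= !lte_fin ltr_nM2r ?invr_lt0// ltrD2r.
  case: ifP => _; last by rewrite mule0.
  rewrite -!EFinB -EFinM; congr EFin.
  rewrite ltr0_norm//; field; exact: a0.
- have -> : f @^-1` `]c, d] = `](c - b) / a, (d - b) / a]%classic.
    apply/seteqP; split=> x /=; rewrite !in_itv/= /f.
      by rewrite ler_pdivlMr// ltr_pdivrMr// mulrC lerBrDr ltrBlDr => /andP[-> ->].
    by rewrite ler_pdivlMr// ltr_pdivrMr// mulrC lerBrDr ltrBlDr => /andP[-> ->].
  rewrite !lebesgue_measure_itv/= !lte_fin ltr_pM2r ?invr_gt0// ltrD2r.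
  case: ifP => _; last by rewrite mule0.
  rewrite -!EFinB -EFinM; congr EFin.
  rewrite gtr0_norm//; field; exact: a0.
Qed.

End LebesgueAffine.

(* [\x] of two sigma-finite measures has no sigma-finite instance in scope:
   the one for subprobability measures shadows it. *)
Section ProductSigmaFinite.
Context d1 d2 (T1 : measurableType d1) (T2 : measurableType d2) (R : realType).
Variable m1 : {sigma_finite_measure set T1 -> \bar R}.
Variable m2 : {sigma_finite_measure set T2 -> \bar R}.

Lemma product_measure_sigma_finite : sigma_finite setT (m1 \x m2)%E.
Proof.
have [F UF Ffin] := sigma_finiteT m1; have [G UG Gfin] := sigma_finiteT m2.
(* Enumerates the pairs of pieces. A code of no pair is sent to (0, 0), which only repeats a
   piece. *)
pose u k : nat * nat := odflt (0, 0)%N (unpickle k).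
exists (fun k => F (u k).1 `*` G (u k).2).
  rewrite -setXTT UF UG; apply/seteqP; split=> [[x y] /= [[i _ Fi] [j _ Gj]]|].
    by exists (pickle (i, j)) => //; rewrite /u pickleK.
  by move=> [x y] [k _ [Fx Gy]]; split; [exists (u k).1|exists (u k).2].
move=> k; have [mF Foo] := Ffin (u k).1; have [mG Goo] := Gfin (u k).2.
split; first exact: measurableX.
by rewrite product_measure1E// lte_mul_pinfty// ge0_fin_numE.
Qed.

Definition product_sigma_finite_measure :
    {sigma_finite_measure set (T1 * T2)%type -> \bar R} :=
  HB.pack_for (SigmaFiniteMeasure.type (T1 * T2)%type R)
    (m1 \x m2)%E (Measure_isSigmaFinite.Build _ _ _ (m1 \x m2)%E
      product_measure_sigma_finite).

End ProductSigmaFinite.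

(* A measurable space standing for R^n as an iterated product, on which
   [euclidean_volume] is a sigma-finite measure. *)
Record borel_model (R : realType) (n : nat) := BorelModel {
  bm_disp : measure_display ;
  bm_sort : measurableType bm_disp ;
  bm_measure : {sigma_finite_measure set bm_sort -> \bar R} ;
  bm_vec : bm_sort -> 'rV[R]_n ;
  bm_of : 'rV[R]_n -> bm_sort ;
  bm_vecK : cancel bm_vec bm_of ;
  bm_ofK : cancel bm_of bm_vec ;
  bm_coord : forall i, measurable_fun setT (fun x => bm_vec x 0 i : R) ;
  bm_measurable_fun : forall d (T : measurableType d) (f : T -> bm_sort),
    (forall i, measurable_fun setT (fun t => bm_vec (f t) 0 i : R)) ->
    measurable_fun setT f ;
  bm_volume : forall A, measurable A ->
    bm_measure A = euclidean_volume (bm_of @^-1` A) }.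

Definition borel_model0 (R : realType) : borel_model R 0.
Proof.
pose m : {sigma_finite_measure set unit -> \bar R} := \d_tt.
apply: (@BorelModel R 0 _ unit m (fun=> 0) (fun=> tt)).
- by case.
- by move=> v; apply/rowP => -[].
- by case.
- move=> d T f _; apply: (@eq_measurable_fun _ _ _ _ _ (cst tt)) => // x _.
  by case: (f x).
- by move=> A _ /=; rewrite /dirac !indicE; do 2 f_equal.
Defined.

(** Closed by [Defined]: later proofs rely on the carrier of [rV_model R n.+1] being convertible to
    a product, so that sections and product measures apply to it directly. *)
Definition borel_modelS (R : realType) n (B : borel_model R n) :
  borel_model R n.+1.
Proof.
pose l : {sigma_finite_measure set (measurableTypeR R) -> \bar R} :=
  @lebesgue_measure R.
pose m := product_sigma_finite_measure l (bm_measure B).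
apply: (@BorelModel R n.+1 _ _ m
  (fun z => row_mx (const_mx z.1 : 'rV[R]_1) (bm_vec z.2) : 'rV[R]_(1 + n))
  (fun v => (lsubmx (v : 'rV[R]_(1 + n)) 0 0,
             bm_of B (rsubmx (v : 'rV[R]_(1 + n)))))).
- by move=> [x y]/=; rewrite row_mxKl row_mxKr bm_vecK mxE.
- move=> v /=; rewrite bm_ofK; apply: etrans (@hsubmxK _ 1 1 n v).
  by f_equal; apply/rowP => i; rewrite mxE ord1.
- move=> i; case: (@split_ordP 1 n i) => j -> /=.
    apply: (eq_measurable_fun (fst : measurableTypeR R * bm_sort B -> R)) => //.
    by move=> z _; symmetry; apply: etrans (row_mxEl _ _ _ _) _; rewrite mxE.
  apply: (eq_measurable_fun (fun z => bm_vec z.2 0 j : R)).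
    by move=> z _; symmetry; exact: row_mxEr.
  exact: measurableT_comp (bm_coord j) measurable_snd.
- move=> d T f mf; apply/measurable_fun_pairP; split.
    apply: eq_measurable_fun (mf (@lshift 1 n 0)) => t _.
    by apply: etrans (row_mxEl _ _ _ _) _; rewrite mxE.
  apply: bm_measurable_fun => i.
  apply: eq_measurable_fun (mf (@rshift 1 n i)) => t _.
  exact: row_mxEr.
- move=> A mA /=; rewrite /product_measure1; apply: eq_integral => x _ /=.
  rewrite bm_volume; last exact: measurable_xsection.
  congr euclidean_volume; apply/seteqP; split => v /=;
  by rewrite /xsection/= ?inE row_mxKl row_mxKr mxE.
Defined.

Fixpoint rV_model (R : realType) n : borel_model R n :=
  if n is n'.+1 then borel_modelS (rV_model R n') else borel_model0 R.

Definition rV_measurable {R : realType} {n} (B : set 'rV[R]_n) :=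
  measurable (bm_vec (b := rV_model R n) @^-1` B).

Section EuclideanVolume.
Context {R : realType}.
Local Notation leb := (@lebesgue_measure R).

Lemma euclidean_volumeE n (B : set 'rV[R]_n) : rV_measurable B ->
  euclidean_volume B = bm_measure (rV_model R n) (bm_vec (b := _) @^-1` B).
Proof.
move=> mB; rewrite bm_volume//; congr euclidean_volume.
by apply/seteqP; split=> v /=; rewrite bm_ofK.
Qed.

Lemma rV_measurable_preimage n1 n2 (f : 'rV[R]_n1 -> 'rV[R]_n2) B :
  (forall i, measurable_fun setT
    (fun x : bm_sort (rV_model R n1) => f (bm_vec x) 0 i : R)) ->
  rV_measurable B -> rV_measurable (f @^-1` B).
Proof.
move=> mf mB.
have mg : measurable_fun setT
    (fun x : bm_sort (rV_model R n1) => bm_of (rV_model R n2) (f (bm_vec x))).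
  by apply: bm_measurable_fun => i; under eq_fun do rewrite bm_ofK; exact: mf.
have := mg measurableT _ mB; rewrite setTI; congr measurable.
by apply/seteqP; split=> v /=; rewrite bm_ofK.
Qed.

Lemma rV_measurable_affine n1 n2 (T : 'M[R]_(n1, n2)) a B :
  rV_measurable B -> rV_measurable [set v | B (v *m T + a)].
Proof.
apply: rV_measurable_preimage => i; under eq_fun do rewrite !mxE.
apply: measurable_funD; last exact: measurable_cst.
apply: measurable_sum => j; apply: measurable_funM; last exact: measurable_cst.
exact: bm_coord.
Qed.

Definition slice n (B : set 'rV[R]_(1 + n)) (x : R) : set 'rV[R]_n :=
  [set v | B (row_mx (const_mx x) v)].

Lemma rV_measurable_slice n (B : set 'rV[R]_(1 + n)) x :
  rV_measurable B -> rV_measurable (slice B x).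
Proof.
move=> /measurable_xsection => /(_ x); rewrite /xsection.
by under eq_set do rewrite inE.
Qed.

Lemma measurable_fun_volume_slice n (B : set 'rV[R]_(1 + n)) :
  rV_measurable B ->
  measurable_fun setT (fun x : measurableTypeR R => euclidean_volume (slice B x)).
Proof.
move=> mB; apply: eq_measurable_fun
  (measurable_fun_xsection (bm_measure (rV_model R n)) mB) => x _ /=.
rewrite euclidean_volumeE; last exact: rV_measurable_slice.
by congr (bm_measure _ _); apply/seteqP; split=> v /=; rewrite /xsection/= inE.
Qed.

Lemma euclidean_volume_ge0 n (B : set 'rV[R]_n) : (0 <= euclidean_volume B)%E.
Proof.
elim: n B => [|n IHn] B /=; first by rewrite lee_fin.
exact: integral_ge0.
Qed.

(** Tonelli: the definition integrates the first coordinate last, here it is integrated first. This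
    is the order suited to maps that move only the first coordinate. *)
Lemma euclidean_volume_fubini n (B : set 'rV[R]_(1 + n)) :
  rV_measurable B ->
  euclidean_volume B =
  (\int[bm_measure (rV_model R n)]_u
    leb [set x | B (row_mx (const_mx x) (bm_vec u))])%E.
Proof.
move=> mB; rewrite euclidean_volumeE//=.
(* Both orders of integration give measures that agree on rectangles, hence everywhere. *)
rewrite (@product_measure_unique _ _ _ _ _ _ _
  (leb \x^ bm_measure (rV_model R n))%E)//.
  rewrite /product_measure2; apply: eq_integral => u _ /=.
  by congr lebesgue_measure; apply/seteqP; split=> x /=; rewrite /ysection/= inE.
by move=> A1 A2 mA1 mA2; exact: product_measure2E.
Qed.

End EuclideanVolume.

(** * Determinant rule by Gaussian elimination *)

Section LinearChange.
Context {R : realType}.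
Local Notation leb := (@lebesgue_measure R).

(** The translation is part of the notion because a shear restricted to a slice becomes a
    translation that depends on the slice. *)
Definition affine_scaling n (T : 'M[R]_n) (a : 'rV[R]_n) :=
  forall B : set 'rV[R]_n, rV_measurable B ->
  euclidean_volume [set v | B (v *m T + a)] =
    (`|\det T|^-1%:E * euclidean_volume B)%E.

Lemma affine_scaling_comp n (S T : 'M[R]_n) a b :
  affine_scaling S a -> affine_scaling T b ->
  affine_scaling (S *m T) (a *m T + b).
Proof.
move=> hS hT B mB.
have := hS _ (rV_measurable_affine T b mB); rewrite hT// muleA -EFinM.
rewrite det_mulmx normrM invfM => <-; congr euclidean_volume.
by apply/seteqP; split=> v /=; rewrite mulmxDl -mulmxA addrA.
Qed.

(** On row vectors the map is (x, v) |-> (t x + v c + b, v): for fixed v it is affine of slope t in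
    x, so the one-dimensional rule applies under the integral over v. *)
Lemma affine_scaling_head n (t : R) (c : 'cV[R]_n) (b : R) : t != 0 ->
  affine_scaling (block_mx (t%:M : 'M[R]_1) 0 c 1%:M)
    (row_mx (const_mx b : 'rV[R]_1) 0 : 'rV[R]_(1 + n)).
Proof.
move=> t0 B mB.
rewrite (euclidean_volume_fubini (rV_measurable_affine _ _ mB)).
rewrite (euclidean_volume_fubini mB).
rewrite det_lblock det1 mulr1 det_scalar1.
rewrite -ge0_integralZl//; last first.
  have := measurable_fun_ysection leb mB.
  apply: eq_measurable_fun => u _ /=; congr lebesgue_measure.
  by apply/seteqP; split=> x /=; rewrite /ysection/= inE.
apply: eq_integral => u _.
rewrite -(@lebesgue_measure_affine _ t ((bm_vec u *m c) 0 0 + b))//; last first.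
  have := measurable_ysection u mB; congr measurable.
  by apply/seteqP; split=> x /=; rewrite /ysection/= inE.
congr lebesgue_measure; apply/seteqP; split=> x /=;
  rewrite (mul_row_block (const_mx x)) mulmx0 mulmx1 add0r;
  rewrite (add_row_mx _ _ (const_mx b)) addr0; congr (B (row_mx _ _));
  apply/rowP => i; rewrite ord1 !mxE big_ord1 !mxE eqxx mulr1n;
  by rewrite mulrC addrA.
Qed.

(** On row vectors the map is (x, v) |-> (x, x r + v D + a): on the slice over x it is [D] followed
    by the translation by x r + a. *)
Lemma affine_scaling_tail n (r a : 'rV[R]_n) (D : 'M[R]_n) :
  (forall a', affine_scaling D a') ->
  affine_scaling (block_mx (1%:M : 'M[R]_1) r 0 D)
    (row_mx (0 : 'rV[R]_1) a : 'rV[R]_(1 + n)).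
Proof.
move=> hD B mB.
rewrite det_ublock det1 mul1r /= -ge0_integralZl//; last 2 first.
- exact: measurable_fun_volume_slice.
- by move=> x _; exact: euclidean_volume_ge0.
apply: eq_integral => x _.
rewrite -(hD (x *: r + a))//; last exact: rV_measurable_slice.
congr euclidean_volume; apply/seteqP; split=> u /=; rewrite /slice/=;
  rewrite (mul_row_block (const_mx x)) mulmx0 mulmx1 addr0;
  rewrite (add_row_mx _ _ 0) addr0; congr (B (row_mx _ _));
  rewrite addrCA addrA; congr (_ + _ + _);
  by apply/rowP => i; rewrite !mxE big_ord1 mxE.
Qed.

(** One elimination step: a nonzero pivot t gives a block LU factorisation whose remaining block [D]
    is the Schur complement, again invertible and of smaller size. *)
Lemma affine_scaling_pivot n (T : 'M[R]_(1 + n)) (a : 'rV[R]_(1 + n)) :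
  (forall (D : 'M[R]_n) a', D \in unitmx -> affine_scaling D a') ->
  T \in unitmx -> ulsubmx T 0 0 != 0 -> affine_scaling T a.
Proof.
move=> IH uT t0; set t := ulsubmx T 0 0 in t0.
pose r := t^-1 *: ursubmx T; pose D := drsubmx T - dlsubmx T *m r.
(* The second factor sends (b, 0) to (b, b r); [a'] corrects the excess b r. *)
pose b := lsubmx a 0 0; pose a' := rsubmx a - b *: r.
have tE : ulsubmx T = t%:M.
  by apply/matrixP => i j; rewrite !ord1 [RHS]mxE eqxx mulr1n.
have TE : T = block_mx (t%:M : 'M[R]_1) 0 (dlsubmx T) 1%:M *m
    block_mx (1%:M : 'M[R]_1) r 0 D.
  rewrite mulmx_block !mulmx1 !mulmx0 !mul0mx !mul1mx !addr0 mul_scalar_mx.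
  by rewrite scalerA mulfV// scale1r addrC subrK -tE submxK.
have aE : a = row_mx (const_mx b : 'rV[R]_1) 0 *m block_mx (1%:M : 'M[R]_1) r 0 D +
    row_mx (0 : 'rV[R]_1) a'.
  rewrite mul_row_block mulmx1 !mul0mx !addr0 add_row_mx addr0.
  have bE : lsubmx a = const_mx b by apply/rowP => i; rewrite ord1 [RHS]mxE.
  have -> : const_mx b *m r = b *: r.
    by apply/rowP => i; rewrite !mxE big_ord1 !mxE.
  by rewrite addrC subrK -bE hsubmxK.
rewrite TE aE; apply: affine_scaling_comp; first exact: affine_scaling_head.
apply: affine_scaling_tail => a''; apply: IH.
move: uT; rewrite TE unitmx_mul => /andP[_].
by rewrite !unitmxE det_ublock det1 mul1r.
Qed.

Lemma euclidean_volume_affine n (T : 'M[R]_n) a B : T \in unitmx ->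
  rV_measurable B -> euclidean_volume [set v | B (v *m T + a)] =
    (`|\det T|^-1%:E * euclidean_volume B)%E.
Proof.
suff : T \in unitmx -> affine_scaling T a by move=> h /h; exact.
elim: n T a {B} => [|n IHn] T a uT.
  move=> B _; rewrite det_mx00 normr1 invr1 mul1e; congr euclidean_volume.
  by apply/seteqP; split=> v /=; congr B; apply/rowP => -[].
have [t0|] := eqVneq (ulsubmx (T : 'M[R]_(1 + n)) 0 0) 0; last first.
  exact: affine_scaling_pivot.
(* A shear brings a nonzero entry of the first column to the pivot. *)
have [i ci0] : exists i, dlsubmx (T : 'M[R]_(1 + n)) i 0 != 0.
  apply/existsP; apply: contraTT uT => /existsPn c0.
  (* Otherwise the first column of [T] is zero and [T] kills a nonzero column vector, against
     invertibility. *)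
  suff c0T : (T : 'M[R]_(1 + n)) *m col_mx (1%:M : 'M[R]_1) 0 = 0.
    apply/negP => uT.
    have := congr1 usubmx (mulKmx (uT : (T : 'M[R]_(1 + n)) \in unitmx)
      (col_mx (1%:M : 'M[R]_1) 0)).
    rewrite c0T mulmx0 col_mxKu => /matrixP/(_ 0 0)/eqP.
    by rewrite !mxE eq_sym oner_eq0.
  rewrite -(submxK (T : 'M[R]_(1 + n))) mul_block_col !mulmx1 !mulmx0 !addr0.
  apply/eqP; rewrite col_mx_eq0; apply/andP; split; apply/eqP.
    by apply/matrixP => j k; rewrite !ord1 t0 mxE.
  apply/matrixP => j k; rewrite ord1 [RHS]mxE; apply/eqP; have := c0 j.
  by rewrite negbK.
pose w : 'rV[R]_n := delta_mx 0 i.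
pose S (u : 'rV[R]_n) : 'M[R]_(1 + n) := block_mx (1%:M : 'M[R]_1) u 0 1%:M.
have SE u : affine_scaling (S u) 0.
  rewrite -(row_mx0 _ _ 1); apply: affine_scaling_tail => a'; apply: IHn.
  exact: unitmx1.
have uS u : S u \in unitmx by rewrite unitmxE det_ublock !det1 mulr1 unitr1.
have -> : T = S (- w) *m (S w *m T).
  rewrite mulmxA mulmx_block !mulmx1 !mulmx0 !mul0mx !addr0 add0r mul1mx subrr.
  by rewrite -scalar_mx_block mul1mx.
have -> : a = 0 *m (S w *m T) + a by rewrite mul0mx add0r.
apply: affine_scaling_comp => //; apply: affine_scaling_pivot => //.
  by rewrite unitmx_mul uS.
have -> : S w *m T = @mulmx _ _ (1 + n) _ (S w) (block_mx
    (ulsubmx (T : 'M[R]_(1 + n))) (ursubmx (T : 'M[R]_(1 + n)))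
    (dlsubmx (T : 'M[R]_(1 + n))) (drsubmx (T : 'M[R]_(1 + n)))).
  by rewrite submxK.
rewrite mulmx_block block_mxKul mul1mx.
rewrite mxE t0 add0r.
rewrite mxE (bigD1 i)//= big1 ?addr0 => [|j ji]; rewrite mxE ?eqxx ?mul1r//.
by rewrite (negPf ji) mul0r.
Qed.

End LinearChange.

(** * Measurability of open sets *)

Section OpenMeasurable.
Context {R : realType}.

(** The norm is the maximum norm, so a ball is a box: a finite intersection of coordinate slabs. *)
Lemma rV_measurable_ball n (q : 'rV[R]_n) (r : R) : 0 < r ->
  rV_measurable (ball q r).
Proof.
move=> r0; rewrite /rV_measurable.
have -> : bm_vec (b := rV_model R n) @^-1` ball q r =
    \bigcap_(i in [set: 'I_n]) [set x | bm_vec x 0 i \in `]q 0 i - r, q 0 i + r[].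
  apply/seteqP; split=> x /=.
    by move=> [_ h] i _; have := h 0 i; rewrite /ball/= ltr_distlC in_itv.
  by move=> h; split=> // i j; rewrite ord1 /ball/= ltr_distlC; have := h j I;
    rewrite /= in_itv.
apply: fin_bigcap_measurable => // i _.
have := @bm_coord _ _ (rV_model R n) i measurableT _
  (measurable_itv `]q 0 i - r, q 0 i + r[).
by rewrite setTI.
Qed.

Lemma rV_measurable_open n (B : set 'rV[R]_n) : open B -> rV_measurable B.
Proof.
move=> oB.
pose rad (k : nat) : R := k.+1%:R^-1.
have rad0 k : 0 < rad k by rewrite invr_gt0.
pose box (z : 'rV[rat]_n * nat) := ball (map_mx ratr z.1 : 'rV[R]_n) (rad z.2).
have -> : B = \bigcup_(z : 'rV[rat]_n * nat)
    (if pselect (box z `<=` B) then box z else set0).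
  apply/seteqP; split=> [v Bv|v [z _]]; last by case: pselect => // zB /zB.
  have /nbhs_ballP[e /= e0 eB] : nbhs v B by apply: open_nbhs_nbhs; split.
  (* The rational centre will lie within [rad k] of [v], so every point of its box is within 2
     [rad k] < e of [v]. *)
  have [k] : exists k, rad k < e / 2.
    by have /ltr_add_invr[k] : 0 < e / 2; [exact: divr_gt0|rewrite add0r; exists k].
  move=> ke.
  have /choice[q qv] : forall i : 'I_n, exists q : rat,
      ratr q \in `]v 0 i - rad k, v 0 i + rad k[.
    by move=> i; apply: rat_in_itvoo; have := rad0 k; lra.
  have qv' : box (\row_i q i, k) v.
    split=> // i j; rewrite ord1 !mxE /ball/= distrC ltr_distlC.
    by have := qv j; rewrite in_itv.
  exists (\row_i q i, k) => //; case: pselect => // -[] w qw; apply: eB.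
  have : ball v (rad k + rad k) w by apply: ball_triangle qw; exact: ball_sym.
  by apply: le_ball; lra.
rewrite /rV_measurable preimage_bigcup.
apply: countable_bigcupT_measurable; first exact: countableP.
move=> z; case: pselect => _ /=; first exact: rV_measurable_ball.
by rewrite preimage_set0.
Qed.

End OpenMeasurable.

(** * Calculus of C^k functions *)

Section NearDifferentiable.
Context {R : realType} {V W : normedModType R}.

Lemma near_eq_diff_aux (f g : V -> W) (x : V) : {near x, f =1 g} ->
  differentiable f x ->
  continuous ('d f x) /\ g \o shift x = cst (g x) + 'd f x +o_ 0 id.
Proof.
move=> fg df; split; first exact: diff_continuous.
have fgx : f x = g x := nbhs_singleton fg.
have /eqaddoP h := diff_locally df.
apply/eqaddoP => e e0; have := h _ e0; apply: filter_app.
have fg0 : \forall y \near 0, f (y + x) = g (y + x).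
  by rewrite (near_shift x)/=; near do rewrite /= sub0r subrK.
by near=> y; rewrite /= !fctE /= fgx (near fg0 y).
Unshelve. all: by end_near. Qed.

Lemma near_eq_diff (f g : V -> W) (x : V) : {near x, f =1 g} ->
  differentiable f x -> 'd g x = 'd f x :> (V -> W).
Proof. by move=> fg df; apply: diff_unique; have [] := near_eq_diff_aux fg df. Qed.

Lemma near_eq_differentiable (f g : V -> W) (x : V) : {near x, f =1 g} ->
  differentiable f x -> differentiable g x.
Proof.
by move=> fg df; apply/diff_locallyP; rewrite (near_eq_diff fg df);
  exact: near_eq_diff_aux.
Qed.

End NearDifferentiable.

Section CkCalculus.
Context {R : realType}.

Lemma near_eq_open {V W : normedModType R} (U : set V) (f g : V -> W) x : open U ->
  (forall x, U x -> f x = g x) -> U x -> {near x, f =1 g}.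
Proof. by move=> oU fg Ux; apply: filterS fg _; exact: open_nbhs_nbhs. Qed.

(** On an open set pointwise equality is equality of germs, so it passes to the derivatives at each
    induction step. *)
Lemma Ck_ext {V W : normedModType R} k (U : set V) (f g : V -> W) : open U ->
  (forall x, U x -> f x = g x) -> Ck k U f -> Ck k U g.
Proof.
move=> oU; elim: k f g => [|k IHk] f g fg /=.
  move=> cf x Ux; rewrite /prop_for /continuous_at -(fg x Ux).
  exact: cvg_trans (near_eq_cvg (near_eq_open oU fg Ux)) (cf x Ux).
move=> [df ckf]; split=> [x Ux|v].
  exact: near_eq_differentiable (near_eq_open oU fg Ux) (df x Ux).
apply: IHk (ckf v) => x Ux; apply: near_eq_derive.
exact: near_eq_open oU fg Ux.
Qed.

Lemma CkW {V W : normedModType R} k (U : set V) (f : V -> W) :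
  Ck k.+1 U f -> Ck k U f.
Proof.
elim: k f => [|k IHk] f [df ckf].
  by move=> x Ux; exact/differentiable_continuous/df.
by split=> // v; apply: IHk; exact: ckf.
Qed.

Lemma Ck_cst {V W : normedModType R} k (U : set V) (c : W) : Ck k U (fun=> c).
Proof.
elim: k c => [|k IHk] c /=; first by move=> x _; exact: cst_continuous.
split=> [x _|v]; first exact: differentiable_cst.
have -> : (fun x => 'D_v (fun=> c) x) = (fun=> 0 : W) :> (V -> W).
  by apply/funext => x; exact: derive_cst.
exact: IHk.
Qed.

Lemma CkD {V W : normedModType R} k (U : set V) (f g : V -> W) : open U ->
  Ck k U f -> Ck k U g -> Ck k U (fun x => f x + g x).
Proof.
move=> oU; elim: k f g => [|k IHk] f g /= => [cf cg x Ux|[df ckf] [dg ckg]].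
  by apply: continuousD; [exact: cf|exact: cg].
split=> [x Ux|v]; first by apply: differentiableD; [exact: df|exact: dg].
apply: Ck_ext (IHk _ _ (ckf v) (ckg v)) => // x Ux.
by rewrite -deriveD//; apply: diff_derivable; [exact: df|exact: dg].
Qed.

Lemma CkM {V : normedModType R} k (U : set V) (f g : V -> R) : open U ->
  Ck k U f -> Ck k U g -> Ck k U (fun x => f x * g x).
Proof.
move=> oU; elim: k f g => [|k IHk] f g => [cf cg x Ux|ckf ckg].
  by apply: continuousM; [exact: cf|exact: cg].
have [[df df'] [dg dg']] := (ckf, ckg).
split=> [x Ux|v]; first by apply: differentiableM; [exact: df|exact: dg].
apply: (Ck_ext oU _ (CkD oU (IHk _ _ (CkW ckf) (dg' v))
                        (IHk _ _ (CkW ckg) (df' v)))) => x Ux.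
by rewrite [RHS]deriveM//; apply: diff_derivable; [exact: df|exact: dg].
Qed.

(** Induction through (1/f)' = - f' / f^2, where the factor 1/f is already known at the lower
    order. *)
Lemma CkV {V : normedModType R} k (U : set V) (f : V -> R) : open U ->
  (forall x, U x -> f x != 0) -> Ck k U f -> Ck k U (fun x => (f x)^-1).
Proof.
move=> oU f0; elim: k => [|k IHk] ckf.
  by move=> x Ux; apply: continuousV; [exact: f0|exact: ckf].
have [df df'] := ckf; have Vf := IHk (CkW ckf).
split=> [x Ux|v]; first by apply: differentiableV; [exact: df|exact: f0].
have := CkM oU (CkM oU Vf Vf) (df' v).
have c1 : Ck k U (fun=> -1 : R) by exact: Ck_cst.
move=> /(CkM oU c1); apply: Ck_ext => // x Ux.
rewrite deriveV ?f0//; last by apply: diff_derivable; exact: df.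
by rewrite scaleNr mulN1r -expr2 exprVn.
Qed.

Lemma Ck_linear {V W : normedModType R} k (U : set V) (f : {linear V -> W}) :
  continuous f -> Ck k U f.
Proof.
move=> cf; case: k => [|k] /=; first by move=> x _; exact: cf.
split=> [x _|v]; first exact: linear_differentiable.
have -> : (fun x => 'D_v f x) = (fun=> f v) :> (V -> W).
  apply/funext => x; rewrite deriveE; last exact: linear_differentiable.
  by rewrite diff_lin.
exact: Ck_cst.
Qed.

End CkCalculus.

Section SmoothCalculus.
Context {R : realType} {V : normedModType R} (U : set V) (oU : open U).

Lemma smooth_ext {W : normedModType R} (f g : V -> W) :
  (forall x, U x -> f x = g x) -> smooth_on U f -> smooth_on U g.
Proof. by move=> fg sf k; exact: Ck_ext (sf k). Qed.

Lemma smooth_cst {W : normedModType R} (c : W) : smooth_on U (fun=> c).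
Proof. by move=> k; exact: Ck_cst. Qed.

Lemma smooth_linear {W : normedModType R} (f : {linear V -> W}) :
  continuous f -> smooth_on U f.
Proof. by move=> cf k; exact: Ck_linear. Qed.

Lemma smooth_derive {W : normedModType R} (f : V -> W) v :
  smooth_on U f -> smooth_on U (fun x => 'D_v f x).
Proof. by move=> sf k; have [_ df] := sf k.+1; exact: df. Qed.

Lemma smooth_differentiable {W : normedModType R} (f : V -> W) x :
  smooth_on U f -> U x -> differentiable f x.
Proof. by move=> sf; have [df _] := sf 1%N; exact: df. Qed.

Lemma smooth_continuous {W : normedModType R} (f : V -> W) x :
  smooth_on U f -> U x -> {for x, continuous f}.
Proof. by move=> sf; exact: (sf 0%N). Qed.

Lemma smoothD {W : normedModType R} (f g : V -> W) :
  smooth_on U f -> smooth_on U g -> smooth_on U (fun x => f x + g x).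
Proof. by move=> sf sg k; exact: CkD. Qed.

Lemma smoothM (f g : V -> R) :
  smooth_on U f -> smooth_on U g -> smooth_on U (fun x => f x * g x).
Proof. by move=> sf sg k; exact: CkM. Qed.

Lemma smoothV (f : V -> R) : (forall x, U x -> f x != 0) ->
  smooth_on U f -> smooth_on U (fun x => (f x)^-1).
Proof. by move=> f0 sf k; exact: CkV. Qed.

Lemma smoothN (f : V -> R) : smooth_on U f -> smooth_on U (fun x => - f x).
Proof.
move=> sf; apply: smooth_ext (smoothM (smooth_cst (-1 : R)) sf) => x _.
by rewrite mulN1r.
Qed.

Lemma smoothB (f g : V -> R) :
  smooth_on U f -> smooth_on U g -> smooth_on U (fun x => f x - g x).
Proof. by move=> sf sg; apply: smoothD => //; exact: smoothN. Qed.

Lemma smooth_sum (I : Type) (r : seq I) (P : pred I) (f : I -> V -> R) :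
  (forall i, P i -> smooth_on U (f i)) ->
  smooth_on U (fun x => \sum_(i <- r | P i) f i x).
Proof.
move=> sf; elim: r => [|i r IHr].
  by apply: smooth_ext (smooth_cst (0 : R)) => x _; rewrite big_nil.
have [Pi|nPi] := boolP (P i).
  by apply: smooth_ext (smoothD (sf i Pi) IHr) => x _; rewrite big_cons Pi.
by apply: smooth_ext IHr => x _; rewrite big_cons (negPf nPi).
Qed.

Lemma smooth_prod (I : Type) (r : seq I) (P : pred I) (f : I -> V -> R) :
  (forall i, P i -> smooth_on U (f i)) ->
  smooth_on U (fun x => \prod_(i <- r | P i) f i x).
Proof.
move=> sf; elim: r => [|i r IHr].
  by apply: smooth_ext (smooth_cst (1 : R)) => x _; rewrite big_nil.
have [Pi|nPi] := boolP (P i).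
  by apply: smooth_ext (smoothM (sf i Pi) IHr) => x _; rewrite big_cons Pi.
by apply: smooth_ext IHr => x _; rewrite big_cons (negPf nPi).
Qed.

Lemma smooth_det n (A : V -> 'M[R]_n) :
  (forall i j, smooth_on U (fun x => A x i j)) ->
  smooth_on U (fun x => \det (A x)).
Proof.
move=> sA; rewrite /determinant; apply: smooth_sum => s _.
apply: smoothM; first exact: smooth_cst.
by apply: smooth_prod.
Qed.

Lemma smooth_invmx n (A : V -> 'M[R]_n) i j :
  (forall i j, smooth_on U (fun x => A x i j)) ->
  (forall x, U x -> A x \in unitmx) ->
  smooth_on U (fun x => invmx (A x) i j).
Proof.
move=> sA uA.
(* Cramer's rule. It agrees with [invmx] only where the matrix is invertible, since elsewhere
   [invmx] returns the matrix itself; hence the comparison on U. *)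
have : smooth_on U (fun x => (\det (A x))^-1 * cofactor (A x) j i).
  apply: smoothM.
    apply: smoothV; last exact: smooth_det.
    by move=> x Ux; rewrite -unitfE -unitmxE; exact: uA.
  apply: smoothM; first exact: smooth_cst.
  apply: smooth_det => i' j'.
  by apply: smooth_ext (sA (lift j i') (lift i j')) => x _; rewrite !mxE.
apply: smooth_ext => x Ux.
by rewrite /invmx uA// !mxE.
Qed.

End SmoothCalculus.

(** * The fundamental form and the Chern connection *)

Section FundamentalForm.
Context {R : realType} {n : nat}.
Implicit Types (f : 'rV[R]_n -> R) (y u v : 'rV[R]_n).

Lemma derive1_line {V W : normedModType R} (h : V -> W) z w :
  derive1 (fun t : R => h (z + t *: w)) 0 = 'D_w h z.
Proof.
rewrite /derive1 /derive; do 2 f_equal; apply/funext => t /=.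
by rewrite addr0 scale0r addr0 [_ + z]addrC.
Qed.

Lemma derive_basis {W : normedModType R} (g : 'rV[R]_n -> W) y u :
  differentiable g y ->
  'D_u g y = \sum_(i < n) u 0 i *: 'D_(base_vector i) g y.
Proof.
move=> dg; rewrite deriveE// [X in 'd g y X]row_sum_delta linear_sum.
by apply: eq_bigr => i _; rewrite linearZ /= deriveE.
Qed.

Lemma fundamental_formE f y u v : fundamental_form f y u v =
  2^-1 * 'D_u (fun z => 'D_v (fun w => f w ^+ 2 : R) z : R) y.
Proof.
pose Q w : R := f w ^+ 2.
apply: (congr1 ( *%R 2^-1)); rewrite -(derive1_line (fun z => 'D_v Q z) y u).
apply: (congr1 (fun g => derive1 g 0)); apply/funext => s.
by rewrite -(derive1_line Q).
Qed.

Lemma open_neq0 : open [set y : 'rV[R]_n | y != 0].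
Proof.
have -> : [set y : 'rV[R]_n | y != 0] = ~` [set 0].
  by apply/seteqP; split=> y /=; [move/eqP|move/eqP].
apply: closed_openC; apply: accessible_closed_set1.
by apply: hausdorff_accessible; exact: norm_hausdorff.
Qed.

(** Bilinearity is not built into the iterated derivatives; it comes from differentiability of f^2
    and of its first derivatives away from the origin. *)
Lemma fundamental_form_mx f y u v : smooth_on [set y | y != 0] f -> y != 0 ->
  fundamental_form f y u v = (u *m fundamental_matrix f y *m v^T) 0 0.
Proof.
move=> sf y0; pose Q w := f w ^+ 2 : R.
have oU := open_neq0.
have sQ : smooth_on [set y | y != 0] Q by exact: smoothM.
have dQ w z : z != 0 -> differentiable (fun z => 'D_w Q z) z.
  by move=> z0; apply: smooth_differentiable (smooth_derive w sQ) _.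
rewrite fundamental_formE -/Q.
(* The inner derivative expands in v at every z != 0, hence on a neighbourhood of y, which is all
   that the outer derivative sees. *)
have -> : 'D_u (fun z => 'D_v Q z) y =
    'D_u (\sum_(j < n) (v 0 j *: (fun z => 'D_(base_vector j) Q z : R))) y.
  apply: near_eq_derive; apply: (@near_eq_open _ _ _ [set y | y != 0]) => //.
  move=> z z0; rewrite (derive_basis _ (smooth_differentiable sQ z0)).
  by rewrite fct_sumE.
rewrite derive_sum; last first.
  by move=> j; apply: derivableZ; apply: diff_derivable; exact: dQ.
rewrite mulr_sumr mxE; apply: eq_bigr => j _.
rewrite deriveZ; last by apply: diff_derivable; exact: dQ.
rewrite derive_basis; last exact: dQ.
rewrite !mxE scaler_sumr mulr_sumr mulr_suml; apply: eq_bigr => i _.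
by rewrite [in RHS]mxE fundamental_formE /GRing.scale /= -/Q; ring.
Qed.

Lemma fundamental_form_comp f (A : 'M[R]_n) y u v :
  fundamental_form (fun w => f (w *m A)) y u v =
  fundamental_form f (y *m A) (u *m A) (v *m A).
Proof.
apply: (congr1 ( *%R 2^-1)); apply: (congr1 (fun g => derive1 g 0)).
apply/funext => s; apply: (congr1 (fun g => derive1 g 0)).
by apply/funext => t; rewrite !mulmxDl !scalemxAl.
Qed.

Lemma fundamental_matrix_comp f (A : 'M[R]_n) y :
  smooth_on [set y | y != 0] f -> y *m A != 0 ->
  fundamental_matrix (fun w => f (w *m A)) y =
  A *m fundamental_matrix f (y *m A) *m A^T.
Proof.
move=> sf yA0; apply/matrixP => i j.
rewrite [LHS]mxE fundamental_form_comp fundamental_form_mx//.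
have -> : base_vector i *m A = row i A by rewrite rowE.
have -> : base_vector j *m A = row j A by rewrite rowE.
rewrite -row_mul !mxE; apply: eq_bigr => k _.
by rewrite !mxE; congr (_ * _); apply: eq_bigr => l _; rewrite !mxE.
Qed.

(** A nonzero u in the left kernel would give g_y(u, u) = 0. *)
Lemma fundamental_matrix_unit f y : smooth_on [set y | y != 0] f -> y != 0 ->
  (forall u, u != 0 -> 0 < fundamental_form f y u u) ->
  fundamental_matrix f y \in unitmx.
Proof.
move=> sf y0 pos; rewrite -row_free_unit -kermx_eq0; apply/eqP/row_matrixP => i.
rewrite row0; apply/eqP/negPn/negP => /pos.
by rewrite fundamental_form_mx// -row_mul mulmx_ker row0 mul0mx mxE ltxx.
Qed.

End FundamentalForm.

(** * Smoothness of the Chern coefficients *)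

Section ChernSmooth.
Context {R : realType} {n : nat}.
Local Notation rV := 'rV[R]_n.
Variables (U : set (rV * rV)) (oU : open U).
Implicit Types (f g : rV -> rV -> R).

(** The coefficients are curried in x and y; joint smoothness lives on the product, where partial
    derivatives become directional ones along (e_k, 0) and (0, e_k). *)
Definition smooth2 f := smooth_on U (fun w : rV * rV => f w.1 w.2 : R).

Lemma smooth2_ext f g : (forall w, U w -> f w.1 w.2 = g w.1 w.2) ->
  smooth2 f -> smooth2 g.
Proof. by move=> fg; exact: smooth_ext. Qed.

Lemma smooth2_cst (c : R) : smooth2 (fun _ _ => c).
Proof. exact: smooth_cst. Qed.

Lemma smooth2D f g : smooth2 f -> smooth2 g -> smooth2 (fun x y => f x y + g x y).
Proof. exact: smoothD. Qed.

Lemma smooth2B f g : smooth2 f -> smooth2 g -> smooth2 (fun x y => f x y - g x y).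
Proof. exact: smoothB. Qed.

Lemma smooth2M f g : smooth2 f -> smooth2 g -> smooth2 (fun x y => f x y * g x y).
Proof. exact: smoothM. Qed.

Lemma smooth2_sum (f : 'I_n -> rV -> rV -> R) : (forall i, smooth2 (f i)) ->
  smooth2 (fun x y => \sum_(i < n) f i x y).
Proof. by move=> sf; apply: smooth_sum => // i _; exact: sf. Qed.

Lemma smooth2_coord k : smooth2 (fun _ y => y 0 k).
Proof.
pose c (w : rV * rV) : R := w.2 0 k.
have lc : linear c by move=> a w z; rewrite /c /= !mxE.
pose cl : {linear (rV * rV)%type -> R} :=
  HB.pack c (GRing.isLinear.Build _ _ _ _ c lc).
apply: (@smooth_linear _ _ U _ cl) => w.
apply: (@continuous_comp _ _ _ snd (fun y : rV => y 0 k)); first exact: cvg_snd.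
exact: coord_continuous.
Qed.

Lemma partial_xE k f x y : partial_x k f x y =
  'D_(base_vector k, 0) (fun w : rV * rV => f w.1 w.2 : R) (x, y).
Proof.
rewrite /partial_x -(derive1_line (fun x' => f x' y : R^o)).
rewrite -(derive1_line (fun w : rV * rV => f w.1 w.2 : R^o)).
apply: (congr1 (fun g : R -> R^o => derive1 g 0 : R)); apply/funext => t /=.
by rewrite scaler0 addr0.
Qed.

Lemma partial_yE k f x y : partial_y k f x y =
  'D_(0, base_vector k) (fun w : rV * rV => f w.1 w.2 : R) (x, y).
Proof.
rewrite /partial_y -(derive1_line (fun y' => f x y' : R^o)).
rewrite -(derive1_line (fun w : rV * rV => f w.1 w.2 : R^o)).
apply: (congr1 (fun g : R -> R^o => derive1 g 0 : R)); apply/funext => t /=.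
by rewrite scaler0 addr0.
Qed.

Lemma smooth2_partial_x k f : smooth2 f -> smooth2 (partial_x k f).
Proof.
move=> /(smooth_derive (base_vector k, 0)); apply: smooth_ext => // -[x y] _.
by rewrite partial_xE.
Qed.

Lemma smooth2_partial_y k f : smooth2 f -> smooth2 (partial_y k f).
Proof.
move=> /(smooth_derive (0, base_vector k)); apply: smooth_ext => // -[x y] _.
by rewrite partial_yE.
Qed.

Variable L : rV -> rV -> R.
Hypothesis sL : smooth2 L.
Hypothesis uL : forall w, U w -> fundamental_matrix (L w.1) w.2 \in unitmx.

Lemma smooth2_metric_coef i j : smooth2 (metric_coef L i j).
Proof.
have sQ := smooth2M sL sL.
apply: smooth2_ext (smooth2M (smooth2_cst 2^-1)
  (smooth2_partial_y i (smooth2_partial_y j sQ))) => -[x y] _ /=.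
by rewrite /metric_coef mxE fundamental_formE.
Qed.

Lemma smooth2_metric_coef_inv i j : smooth2 (metric_coef_inv L i j).
Proof. by apply: smooth_invmx => // i' j'; exact: smooth2_metric_coef. Qed.

Lemma smooth2_formal_christoffel i j k : smooth2 (formal_christoffel L i j k).
Proof.
apply: smooth2M (smooth2_cst _) _; apply: smooth2_sum => s.
apply: smooth2M; first exact: smooth2_metric_coef_inv.
apply: smooth2D; last exact/smooth2_partial_x/smooth2_metric_coef.
by apply: smooth2B; exact/smooth2_partial_x/smooth2_metric_coef.
Qed.

Lemma smooth2_cartan_coef i j k : smooth2 (cartan_coef L i j k).
Proof.
apply: smooth2M (smooth2_cst _) _; apply: smooth2_sum => s.
apply: smooth2M; first exact: smooth2_metric_coef_inv.
exact/smooth2_partial_y/smooth2_metric_coef.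
Qed.

Lemma smooth2_nonlinear_coef i j : smooth2 (nonlinear_coef L i j).
Proof.
apply: smooth2B.
  apply: smooth2_sum => k; apply: smooth2M; last exact: smooth2_coord.
  exact: smooth2_formal_christoffel.
do 3 (apply: smooth2_sum => ?).
apply: smooth2M; last exact: smooth2_coord.
apply: smooth2M; last exact: smooth2_coord.
by apply: smooth2M; [exact: smooth2_cartan_coef|exact: smooth2_formal_christoffel].
Qed.

Lemma smooth2_horizontal_der k f : smooth2 f -> smooth2 (horizontal_der L k f).
Proof.
move=> sf; apply: smooth2B; first exact: smooth2_partial_x.
apply: smooth2_sum => s; apply: smooth2M; last exact: smooth2_partial_y.
exact: smooth2_nonlinear_coef.
Qed.

Lemma smooth2_chern_coef i j k : smooth2 (chern_coef L i j k).
Proof.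
apply: smooth2M (smooth2_cst _) _; apply: smooth2_sum => s.
apply: smooth2M; first exact: smooth2_metric_coef_inv.
apply: smooth2D; last exact/smooth2_horizontal_der/smooth2_metric_coef.
by apply: smooth2B; exact/smooth2_horizontal_der/smooth2_metric_coef.
Qed.

End ChernSmooth.

(** * Uniqueness for second-order equations *)

Section LocalLipschitz.
Context {R : realType} {n : nat}.
Local Notation rV := 'rV[R]_n.

Lemma coord_norm_le (v : rV) i : `|v 0 i| <= `|v|.
Proof.
rewrite [leRHS]/Num.Def.normr/= mx_normrE.
exact: (le_bigmax _ (fun ij : 'I_1 * 'I_n => `|v ij.1 ij.2|) (0, i)).
Qed.

Lemma pair_norm1_le (v : rV * rV) : `|v.1| <= `|v|.
Proof. by rewrite prod_normE le_max lexx. Qed.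

Lemma pair_norm2_le (v : rV * rV) : `|v.2| <= `|v|.
Proof. by rewrite prod_normE le_max lexx orbT. Qed.

Lemma is_derive_line (V W : normedModType R) (f : V -> W) (w v : V) (t : R) :
  derivable f (w + t *: v) v ->
  is_derive t 1 (fun s => f (w + s *: v)) ('D_v f (w + t *: v)).
Proof.
have E : (fun h : R => h^-1 *:
      (((fun s => f (w + s *: v)) \o shift t) (h *: 1) - f (w + t *: v))) =
    (fun h => h^-1 *: ((f \o shift (w + t *: v)) (h *: v) - f (w + t *: v))).
  apply/funext => h /=; do 2 f_equal.
  by rewrite scalerDl [_ *: 1]mulr1 addrCA.
by move=> df; apply: DeriveDef; rewrite /derivable /derive E.
Qed.

Lemma ball_segment (V : normedModType R) (w0 w w' : V) (r t : R) :
  ball w0 r w -> ball w0 r w' -> 0 <= t <= 1 -> ball w0 r (w' + t *: (w - w')).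
Proof.
rewrite -!ball_normE /ball_ /= => hw hw' /andP[t0 t1].
have -> : w0 - (w' + t *: (w - w')) = t *: (w0 - w) + (1 - t) *: (w0 - w').
  have -> : w - w' = (w0 - w') - (w0 - w) by rewrite opprB [RHS]addrC addrA subrK.
  by rewrite opprD addrA scalerBr opprB scalerBl scale1r addrCA.
apply: le_lt_trans (ler_normD _ _) _; rewrite !normrZ.
rewrite (ger0_norm t0) ger0_norm ?subr_ge0//.
(* Strictness will be drawn from the term with factor t, which is lost at t = 0. *)
have [->|tn0] := eqVneq t 0; first by rewrite mul0r add0r subr0 mul1r.
have {tn0}t0 : 0 < t by rewrite lt_def tn0.
have := mulr_ge0 (_ : 0 <= 1 - t) (_ : 0 <= r - `|w0 - w'|).
rewrite !subr_ge0 => /(_ t1 (ltW hw')).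
have : 0 < t * (r - `|w0 - w|) by rewrite mulr_gt0// subr_gt0.
by rewrite !mulrBr !mulrBl !mul1r; lra.
Qed.

Lemma derive_pair_basis (f : rV * rV -> R) w v : differentiable f w ->
  'D_v f w = \sum_(i < n) v.1 0 i * 'D_(base_vector i, 0) f w +
             \sum_(i < n) v.2 0 i * 'D_(0, base_vector i) f w.
Proof.
move=> df.
have vE : v = \sum_(i < n) v.1 0 i *: (base_vector i, 0) +
    \sum_(i < n) v.2 0 i *: (0, base_vector i).
  apply: injective_projections => /=.
    rewrite !(big_morph fst (fun _ _ => erefl) erefl) /= [LHS]row_sum_delta.
    by rewrite [X in _ + X]big1 ?addr0// => i _; rewrite scaler0.
  rewrite !(big_morph snd (fun _ _ => erefl) erefl) /= [LHS]row_sum_delta.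
  by rewrite [X in X + _]big1 ?add0r// => i _; rewrite scaler0.
rewrite deriveE// [X in 'd f w X]vE linearD !linear_sum.
by congr (_ + _); apply: eq_bigr => i _; rewrite linearZ deriveE.
Qed.

Lemma smooth_locally_lipschitz (U : set (rV * rV)) (f : rV * rV -> R) w0 :
  open U -> smooth_on U f -> U w0 -> exists2 r, 0 < r & exists2 K, 0 <= K &
    forall w w', ball w0 r w -> ball w0 r w' -> `|f w - f w'| <= K * `|w - w'|.
Proof.
move=> oU sf Uw0.
pose b1 i : rV * rV := (base_vector i, 0).
pose b2 i : rV * rV := (0, base_vector i).
(* By continuity each partial derivative near [w0] exceeds its size at [w0] by at most 1. The mean
   value theorem on a segment, with every coordinate of w - w' bounded by its norm, then gives the
   sum as Lipschitz constant. *)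
pose K := \sum_(i < n) (`|'D_(b1 i) f w0| + 1) +
  \sum_(i < n) (`|'D_(b2 i) f w0| + 1).
have bound v : \forall w \near w0, `|'D_v f w| <= `|'D_v f w0| + 1.
  have /cvgr_dist_lt := smooth_continuous (smooth_derive v sf) Uw0.
  move=> /(_ 1 ltr01); apply: filterS => w hw.
  rewrite -lerBlDl; apply: le_trans (ltW hw).
  by rewrite distrC; exact: lerB_dist.
have /nbhs_ballP[r /= r0 hr] : \forall w \near w0, [/\ U w,
    forall i, `|'D_(b1 i) f w| <= `|'D_(b1 i) f w0| + 1 &
    forall i, `|'D_(b2 i) f w| <= `|'D_(b2 i) f w0| + 1].
  have n1 : \forall w \near w0, U w by exact: open_nbhs_nbhs.
  have n2 : \forall w \near w0, forall i : 'I_n,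
      `|'D_(b1 i) f w| <= `|'D_(b1 i) f w0| + 1.
    apply: (@filter_forall _ _ _ _ (nbhs_filter w0)) => i; exact: bound.
  have n3 : \forall w \near w0, forall i : 'I_n,
      `|'D_(b2 i) f w| <= `|'D_(b2 i) f w0| + 1.
    apply: (@filter_forall _ _ _ _ (nbhs_filter w0)) => i; exact: bound.
  by apply: filterS3 n1 n2 n3.
exists r => //; exists K.
  by rewrite addr_ge0// sumr_ge0// => i _; rewrite addr_ge0.
move=> w w' bw bw'; pose v := w - w'.
pose h (t : R) : R := f (w' + t *: v).
have inB (t : R) : 0 <= t <= 1 -> ball w0 r (w' + t *: v) by exact: ball_segment.
have dh (t : R) : 0 <= t <= 1 -> is_derive t 1 h ('D_v f (w' + t *: v)).
  move=> t01; have [Ut _ _] := hr _ (inB t t01).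
  have dft := smooth_differentiable sf Ut.
  exact/is_derive_line/diff_derivable.
have [t| |t /[!in_itv]/= t01] :=
  @MVT_segment _ h (fun t => 'D_v f (w' + t *: v)) 0 1 ler01.
- by rewrite in_itv/= => /andP[t0 t1]; apply: dh; rewrite !ltW.
- apply: derivable_within_continuous => t; rewrite in_itv/= => t01.
  by have [] := dh t t01.
rewrite /h scale1r scale0r addr0 subr0 mulr1 [w' + v]addrC subrK => ->.
have [Ut h1 h2] := hr _ (inB t t01).
rewrite derive_pair_basis; last exact: smooth_differentiable sf Ut.
rewrite (le_trans (ler_normD _ _))// mulrDl lerD//.
  rewrite (le_trans (ler_norm_sum _ _ _))// mulr_suml ler_sum// => i _.
  rewrite normrM mulrC; apply: ler_pM => //; first exact: h1.
  exact: le_trans (coord_norm_le _ _) (pair_norm1_le _).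
rewrite (le_trans (ler_norm_sum _ _ _))// mulr_suml ler_sum// => i _.
rewrite normrM mulrC; apply: ler_pM => //; first exact: h2.
exact: le_trans (coord_norm_le _ _) (pair_norm2_le _).
Qed.

End LocalLipschitz.

Section OdeUniqueness.
Context {R : realType}.

(* At a maximum of S = sum |z_i| over [-d, d], the mean value theorem gives
   S <= #|I| K d S, which forces S = 0 for small d. *)
Lemma derive_bound_eq0 (I : finType) (z dz : I -> R -> R) (e K : R) :
  0 < e -> 0 <= K -> (forall i, z i 0 = 0) ->
  (forall t : R, `|t| < e -> forall i, is_derive t 1 (z i) (dz i t)) ->
  (forall t : R, `|t| < e -> forall i, `|dz i t| <= K * \sum_j `|z j t|) ->
  exists2 d, 0 < d & forall t : R, `|t| <= d -> forall i, z i t = 0.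
Proof.
move=> e0 K0 z0 dzE dzK; pose S t := \sum_j `|z j t|.
pose m := #|I|%:R : R.
have m0 : 0 <= m by [].
(* The second bound forces m K d <= 1/2, with +1 guarding against m K = 0; e / 2 keeps the closed
   interval inside the open one. *)
pose d := Num.min (e / 2) (2^-1 / (m * K + 1)).
have mK : 0 < m * K + 1 by rewrite ltr_wpDl// mulr_ge0.
have d0 : 0 < d by rewrite lt_min !divr_gt0// invr_gt0.
have de t : `|t| <= d -> `|t| < e.
  by rewrite /d le_min => /andP[te _]; apply: le_lt_trans te _; lra.
have dK : m * (K * d) <= 2^-1.
  have : d * (m * K + 1) <= 2^-1 by rewrite -ler_pdivlMr// ge_min lexx orbT.
  by have := mulr_ge0 m0 K0; nra.
have itvd (t : R) : t \in `[- d, d] -> `|t| <= d by rewrite in_itv/= ler_norml.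
have cz i : {in `[- d, d], forall t, {for t, continuous (z i)}}.
  move=> t /itvd /de te; apply/differentiable_continuous/derivable1_diffP.
  by have [] := dzE t te i.
have cS : {within `[- d, d], continuous S}.
  apply: continuous_in_subspaceT => t; rewrite inE => td.
  apply: cvg_big => [|j _]; first exact: add_continuous.
  have czt : z j @ t --> z j t by apply: cz.
  exact: cvg_norm czt.
have [||c cd Sc] := @EVT_max R S (- d) d; [lra|exact: cS|].
have S0 t : 0 <= S t by exact: sumr_ge0.
have zc i : `|z i c| <= K * d * S c.
  have main a b : a <= b -> {subset `[a, b] <= `[- d, d]} ->
      `|z i b - z i a| <= K * S c * `|b - a|.
    move=> ab abd.
    have [t tab| |t tab ->] := @MVT_segment _ (z i) (dz i) a b ab.
    - by apply: dzE; apply/de/itvd/abd; exact: subset_itv_oo_cc tab.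
    - apply: continuous_in_subspaceT => t; rewrite inE => tab.
      by apply: cz; exact: abd.
    rewrite normrM ler_wpM2r//; apply: le_trans (dzK _ _ _) _.
      exact/de/itvd/abd.
    by rewrite ler_wpM2l//; apply: Sc; exact: abd.
  have cd' := itvd _ cd.
  suff : `|z i c| <= K * S c * `|c|.
    by move=> /le_trans; apply; rewrite mulrAC ler_wpM2r// ler_wpM2l.
  move: cd; rewrite in_itv/= => /andP[c1 c2].
  have [c0|c0] := leP 0 c.
    have := main 0 c c0; rewrite z0 !subr0; apply => t; rewrite !in_itv/=; lra.
  have := main c 0 (ltW c0); rewrite z0 !sub0r !normrN; apply => t.
  by rewrite !in_itv/=; lra.
have Sc0 : S c <= 0.
  have : S c <= \sum_(j in I) (K * d * S c) by apply: ler_sum => j _; exact: zc.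
  rewrite sumr_const -[_ *+ _]mulr_natl -/m mulrA => h.
  have : m * (K * d) * S c <= 2^-1 * S c by rewrite ler_wpM2r.
  lra.
exists d => // t td i; apply/normr0_eq0/le_anti; rewrite normr_ge0 andbT.
apply: le_trans (_ : S t <= 0).
  by rewrite /S (bigD1 i)//= lerDl sumr_ge0.
by apply: le_trans Sc0; apply: Sc; rewrite in_itv/= -ler_norml.
Qed.

End OdeUniqueness.

Lemma near0P {R : realType} (P : R -> Prop) : (\forall t \near 0, P t) ->
  exists2 e, 0 < e & forall t, `|t| < e -> P t.
Proof.
move=> /nbhs_ballP[e /= e0 he]; exists e => // t te; apply: he.
by rewrite -ball_normE /= sub0r normrN.
Qed.

Lemma near0I {R : realType} (P : R -> Prop) e : 0 < e ->
  (forall t, `|t| < e -> P t) -> \forall t \near 0, P t.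
Proof.
move=> e0 he; apply/nbhs_ballP; exists e => // t.
by rewrite -ball_normE /= sub0r normrN; exact: he.
Qed.

Lemma cvg_near_ball {R : realType} {V : normedModType R} (x : R -> V) (t r : R) l :
  0 < r -> x @ t --> l -> \forall s \near t, ball l r (x s).
Proof. by move=> r0 h; exact: h _ (nbhsx_ballx _ _ r0). Qed.

Section SecondOrder.
Context {R : realType} {n : nat}.
Local Notation rV := 'rV[R]_n.

Lemma is_derive_coord (x : R -> rV) (t : R) dx i : is_derive t 1 x dx ->
  is_derive t 1 (fun s => x s 0 i) (dx 0 i).
Proof.
move=> [dxt <-]; have := (derivable_mxP _ _ _).1 dxt 0 i => dxi.
by rewrite derive_mx// mxE; exact: derivableP.
Qed.

Lemma is_derive_continuous (x : R -> rV) (t : R) dx : is_derive t 1 x dx ->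
  x @ t --> x t.
Proof.
move=> [xt _]; have dxt : differentiable x t by apply/derivable1_diffP.
exact: differentiable_continuous dxt.
Qed.

(** Both curves are continuous at 0 with their velocities, so near 0 they stay in a ball where [h]
    is Lipschitz; the differences then satisfy a linear differential inequality. *)
Lemma second_order_unique (U : set (rV * rV)) (h : 'I_n -> rV * rV -> R)
    (x1 x2 y1 y2 a1 a2 : R -> rV) :
  open U -> (forall i, smooth_on U (h i)) -> U (x1 0, y1 0) ->
  x1 0 = x2 0 -> y1 0 = y2 0 ->
  (\forall t \near (0 : R), is_derive (t : R) 1 x1 (y1 t) /\
    is_derive (t : R) 1 y1 (a1 t)) ->
  (\forall t \near (0 : R), is_derive (t : R) 1 x2 (y2 t) /\
    is_derive (t : R) 1 y2 (a2 t)) ->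
  (\forall t \near 0, forall i, a1 t 0 i = h i (x1 t, y1 t)) ->
  (\forall t \near 0, forall i, a2 t 0 i = h i (x2 t, y2 t)) ->
  \forall t \near 0, x1 t = x2 t.
Proof.
move=> oU sh Uw0 x12 y12 d1 d2 e1 e2.
have cvgw (x y a : R -> rV) :
    (\forall t \near (0 : R), is_derive (t : R) 1 x (y t) /\
      is_derive (t : R) 1 y (a t)) ->
    (fun t => (x t, y t)) @ 0 --> (x 0, y 0).
  move=> /nbhs_singleton[/is_derive_continuous cx /is_derive_continuous cy].
  exact: cvg_pair cx cy.
have lip i : exists K, 0 <= K /\ \forall t \near 0,
    `|a1 t 0 i - a2 t 0 i| <= K * `|(x1 t, y1 t) - (x2 t, y2 t)|.
  have [r r0 [K K0 hK]] := smooth_locally_lipschitz oU (sh i) Uw0.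
  exists K; split=> //.
  have b1 : \forall t \near 0, ball (x1 0, y1 0) r (x1 t, y1 t).
    exact: cvg_near_ball r0 (cvgw _ _ _ d1).
  have b2 : \forall t \near 0, ball (x1 0, y1 0) r (x2 t, y2 t).
    by rewrite x12 y12; exact: cvg_near_ball r0 (cvgw _ _ _ d2).
  apply: filterS2 (filterI b1 b2) (filterI e1 e2) => t [bt1 bt2] [-> ->].
  exact: hK.
have /choice[K KP] := lip.
(* The 1 serves the position differences, whose derivatives are the velocity differences themselves;
   the K i serve the accelerations. *)
pose Kt := 1 + \sum_i K i.
have Kle i : K i <= Kt.
  rewrite /Kt (bigD1 i)//= addrCA lerDl addr_ge0// sumr_ge0// => j _.
  by have [] := KP j.
have nlip : \forall t \near 0, forall i : 'I_n,
    `|a1 t 0 i - a2 t 0 i| <= K i * `|(x1 t, y1 t) - (x2 t, y2 t)|.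
  by apply: (@filter_forall _ _ _ _ (nbhs_filter (0 : R))) => i; case: (KP i).
have [e e0 he] := near0P (filterI (filterI d1 d2) nlip).
(* Reduction to first order: [true] indexes positions, [false] velocities. *)
pose z (bi : bool * 'I_n) t := if bi.1 then x1 t 0 bi.2 - x2 t 0 bi.2
                               else y1 t 0 bi.2 - y2 t 0 bi.2.
pose dz (bi : bool * 'I_n) t := if bi.1 then y1 t 0 bi.2 - y2 t 0 bi.2
                               else a1 t 0 bi.2 - a2 t 0 bi.2.
have zle bi t : `|z bi t| <= \sum_j `|z j t|.
  by rewrite (bigD1 bi)//= lerDl sumr_ge0.
have Kt1 : 1 <= Kt.
  by rewrite lerDl sumr_ge0// => j _; have [] := KP j.
have S0 t : 0 <= \sum_j `|z j t| by exact: sumr_ge0.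
have [||||d d0 zd] := @derive_bound_eq0 R _ z dz e Kt e0.
- by rewrite (le_trans _ Kt1).
- by move=> [[] i]; rewrite /z /= ?x12 ?y12 subrr.
- move=> t /he [[[dx1 dy1] [dx2 dy2]] _] [[] i]; rewrite /z /dz /=.
    by apply: is_deriveB; exact: is_derive_coord.
  by apply: is_deriveB; exact: is_derive_coord.
- move=> t /he [_ ht] [[] i].
    rewrite /dz /=; apply: le_trans (zle (false, i) t) _.
    by rewrite ler_peMl.
  rewrite /dz /=; apply: le_trans (ht i) _.
  apply: ler_pM => //; first by have [] := KP i.
  rewrite prod_normE ge_max /=; apply/andP; split.
  + rewrite [leLHS]/Num.Def.normr/= mx_normrE; apply: bigmax_le => // -[i0 j] _ /=.
    by rewrite ord1 !mxE; exact: (zle (true, j) t).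
  + rewrite [leLHS]/Num.Def.normr/= mx_normrE; apply: bigmax_le => // -[i0 j] _ /=.
    by rewrite ord1 !mxE; exact: (zle (false, j) t).
apply: near0I d0 _ => t td.
apply/rowP => i; apply/eqP; rewrite -subr_eq0; apply/eqP.
exact: (zd t (ltW td) (true, i)).
Qed.

End SecondOrder.

(** * Charts and tangent maps *)

Section Jacobian.
Context {R : realType}.

Lemma diff_jacobian n1 n2 (f : 'rV[R]_n1 -> 'rV[R]_n2) u v :
  'd f u v = v *m jacobian f u.
Proof. by rewrite /jacobian mul_rV_lin1. Qed.

Lemma diff_near_id {V : normedModType R} (f : V -> V) u :
  (\forall v \near u, f v = v) -> 'd f u = id :> (V -> V).
Proof.
move=> fid; have idf : {near u, id =1 f} by apply: filterS fid => v ->.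
by rewrite (near_eq_diff idf)// diff_val.
Qed.

(** The chain rule gives a one-sided inverse, which suffices for square matrices. *)
Lemma jacobian_inv n (f g : 'rV[R]_n -> 'rV[R]_n) u :
  differentiable f u -> differentiable g (f u) ->
  (\forall v \near u, g (f v) = v) -> jacobian f u \in unitmx.
Proof.
move=> df dg gf.
have E v : 'd g (f u) ('d f u v) = v.
  have h1 : 'd (g \o f) u v = 'd g (f u) ('d f u v).
    exact: (congr1 (@^~ v) (diff_comp df dg)).
  have h2 : 'd (g \o f) u v = v.
    exact: (congr1 (@^~ v) (diff_near_id gf)).
  exact: etrans (esym h1) h2.
have JE : jacobian f u *m jacobian g (f u) = 1%:M.
  apply/row_matrixP => i; rewrite !rowE mulmxA mulmx1.
  by rewrite -(diff_jacobian f) -(diff_jacobian g) E.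
exact: (mulmx1_unit JE).1.
Qed.

End Jacobian.

Section Charts.
Context {R : realType} {n : nat} {M : topologicalType}.
Implicit Types (phi : chart R n M).

Lemma cimg_cmap phi x : cdom phi x -> cimg phi (phi x).
Proof. by move=> phix; exists x. Qed.

Lemma cinvK phi u : cimg phi u -> phi (cinv phi u) = u.
Proof. by move=> [x phix <-]; rewrite cmapK. Qed.

Lemma near_cimg phi x : cdom phi x -> \forall u \near phi x, cimg phi u.
Proof.
by move=> px; apply: open_nbhs_nbhs; split; [exact: cimg_open|exact: cimg_cmap].
Qed.

Lemma near_cdom phi x : cdom phi x -> \forall y \near x, cdom phi y.
Proof. by move=> px; apply: open_nbhs_nbhs; split => //; exact: cdom_open. Qed.

Lemma cinv_cvg phi x : cdom phi x -> cinv phi @ phi x --> x.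
Proof.
move=> px; have := @cinv_continuous _ _ _ phi _ (cimg_cmap px).
by rewrite /prop_for /continuous_at cmapK.
Qed.

Context (A : smooth_manifold R n M).

Lemma transition_differentiable phi psi x : atlas A phi -> atlas A psi ->
  cdom phi x -> cdom psi x -> differentiable (fun u => psi (cinv phi u)) (phi x).
Proof.
move=> aphi apsi px qx; apply: smooth_differentiable (chart_compat aphi apsi) _.
by exists x.
Qed.

Lemma chart_vectorE phi u v : chart_vector A phi u v =
  v *m jacobian (fun u' => chart_at A (cinv phi u) (cinv phi u')) u.
Proof. exact: diff_jacobian. Qed.

Lemma chart_vector_unit phi u : atlas A phi -> cimg phi u ->
  jacobian (fun u' => chart_at A (cinv phi u) (cinv phi u')) u \in unitmx.
Proof.
move=> aphi [x px <-]; rewrite cmapK//.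
have ax := chart_at_atlas A x; have qx := mem_chart_at A x.
apply: (@jacobian_inv _ _ _ (fun v => phi (cinv (chart_at A x) v))).
- exact: transition_differentiable.
- by rewrite cmapK//; exact: transition_differentiable.
have h : \forall u \near phi x, cdom (chart_at A x) (cinv phi u).
  exact: cinv_cvg px _ (near_cdom qx).
apply: filterS2 h (near_cimg px) => v qv pv.
by rewrite cmapK// cinvK.
Qed.

End Charts.

Section Velocity.
Context {R : realType}.

(** Chain rule without transition maps: both sides use the charts selected at c(t) and f(c(t)), and
    near t the curve stays in the first. *)
Lemma velocity_map n1 n2 (M1 M2 : topologicalType)
    (A1 : smooth_manifold R n1 M1) (A2 : smooth_manifold R n2 M2)
    (f : M1 -> M2) (c : R -> M1) t :
  {for t, continuous c} ->
  differentiable (fun s : R => chart_at A1 (c t) (c s)) t ->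
  differentiable (fun u => chart_at A2 (f (c t)) (f (cinv (chart_at A1 (c t)) u)))
    (chart_at A1 (c t) (c t)) ->
  velocity A2 (fun s => f (c s)) t = tangent_map A1 A2 f (c t) (velocity A1 c t).
Proof.
move=> cc dc df; rewrite /velocity /tangent_map !derive1E.
set phi := chart_at A1 (c t) in dc df *; set psi := chart_at A2 (f (c t)) in df *.
set F := (fun u => psi (f (cinv phi u))) in df *.
set x := (fun s => phi (c s)) in dc *.
rewrite (@near_eq_derive _ _ _ _ (F \o x)).
  rewrite deriveE; last exact: (differentiable_comp dc df).
  by rewrite (diff_comp dc df) /= deriveE.
have h : \forall s \near t, cdom phi (c s).
  exact: cc _ (near_cdom (mem_chart_at _ _)).
by apply: filterS h => s ps; rewrite /F /x /= cmapK.
Qed.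

Lemma velocity_shift n (M : topologicalType) (A : smooth_manifold R n M)
    (c : R -> M) t : velocity A (fun s => c (t + s)) 0 = velocity A c t.
Proof.
rewrite /velocity /derive1 addr0; do 2 f_equal.
by apply/funext => s; rewrite !addr0 [t + s]addrC.
Qed.

Lemma near_eq_velocity n (M : topologicalType) (A : smooth_manifold R n M)
    (c1 c2 : R -> M) t : (\forall s \near t, c1 s = c2 s) ->
  velocity A c1 t = velocity A c2 t.
Proof.
move=> c12; rewrite /velocity !derive1E (nbhs_singleton c12).
by apply: near_eq_derive; apply: filterS c12 => s ->.
Qed.

Lemma smooth_curve_differentiable n (M : topologicalType)
    (A : smooth_manifold R n M) (I : set R) (c : R -> M) t : I t ->
  smooth_curve A I c -> differentiable (fun s : R => chart_at A (c t) (c s)) t.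
Proof.
move=> It [_ sc]; apply: smooth_differentiable (sc _ (chart_at_atlas _ _)) _.
by split=> //; exact: mem_chart_at.
Qed.

End Velocity.

(** * Differentials of the group action *)

Section ActionDifferentials.
Context {R : realType} {n k : nat} {M : topologicalType} {G : topGroupType}.
Variables (AG : smooth_manifold R k G) (AM : smooth_manifold R n M).
Variable act : G -> M -> M.
Hypothesis sact : smooth_action AG AM act.

(** Joint smoothness in product charts, composed with u |-> (coordinates of g, u). *)
Lemma act_differentiable g x :
  differentiable (fun u => chart_at AM (act g x) (act g (cinv (chart_at AM x) u)))
    (chart_at AM x x).
Proof.
have [_ _ [_ /(_ (chart_at AG g) (chart_at AM x) (chart_at AM (act g x)))]] := sact.
move=> /(_ (chart_at_atlas _ _) (chart_at_atlas _ _) (chart_at_atlas _ _)) sm.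
pose w u : 'rV[R]_k * 'rV[R]_n := (chart_at AG g g, u).
have dw : differentiable w (chart_at AM x x) by exact: differentiable_pair.
have Uw : [/\ cimg (chart_at AG g) (w (chart_at AM x x)).1,
    cimg (chart_at AM x) (w (chart_at AM x x)).2 &
    cdom (chart_at AM (act g x)) (act (cinv (chart_at AG g) (w (chart_at AM x x)).1)
      (cinv (chart_at AM x) (w (chart_at AM x x)).2))].
  split; [exact/cimg_cmap/mem_chart_at|exact/cimg_cmap/mem_chart_at|].
  by rewrite /= !cmapK; exact: mem_chart_at.
have := differentiable_comp dw (smooth_differentiable sm Uw).
by rewrite /comp /= cmapK//; exact: mem_chart_at.
Qed.

Lemma orbit_differentiable g x :
  differentiable (fun u => chart_at AM (act g x) (act (cinv (chart_at AG g) u) x))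
    (chart_at AG g g).
Proof.
have [_ _ [_ /(_ (chart_at AG g) (chart_at AM x) (chart_at AM (act g x)))]] := sact.
move=> /(_ (chart_at_atlas _ _) (chart_at_atlas _ _) (chart_at_atlas _ _)) sm.
pose w u : 'rV[R]_k * 'rV[R]_n := (u, chart_at AM x x).
have dw : differentiable w (chart_at AG g g) by exact: differentiable_pair.
have Uw : [/\ cimg (chart_at AG g) (w (chart_at AG g g)).1,
    cimg (chart_at AM x) (w (chart_at AG g g)).2 &
    cdom (chart_at AM (act g x)) (act (cinv (chart_at AG g) (w (chart_at AG g g)).1)
      (cinv (chart_at AM x) (w (chart_at AG g g)).2))].
  split; [exact/cimg_cmap/mem_chart_at|exact/cimg_cmap/mem_chart_at|].
  by rewrite /= !cmapK; exact: mem_chart_at.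
have := differentiable_comp dw (smooth_differentiable sm Uw).
by rewrite /comp /= cmapK//; exact: mem_chart_at.
Qed.

Lemma act_continuous g : continuous (act g).
Proof.
move=> x; have [_ _ [ca _]] := sact.
apply: (@continuous_comp _ _ _ (fun x => (g, x)) (fun z => act z.1 z.2)).
  by apply: cvg_pair; [exact: cvg_cst|exact: cvg_id].
exact: ca.
Qed.

Lemma actK g x : act g^-1%g (act g x) = x.
Proof. by rewrite -(actM sact) mulVg (act1 sact). Qed.

Definition act_jacobian g x : 'M[R]_n :=
  jacobian (fun u => chart_at AM (act g x) (act g (cinv (chart_at AM x) u)))
    (chart_at AM x x).

Lemma tangent_actE g x v : tangent_map AM AM (act g) x v = v *m act_jacobian g x.
Proof. exact: diff_jacobian. Qed.

(** The action of g^-1, read in the same charts, is a local left inverse. *)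
Lemma act_jacobian_unit g x : act_jacobian g x \in unitmx.
Proof.
have qx := mem_chart_at AM x.
apply: (@jacobian_inv _ _ _ (fun v => chart_at AM (act g^-1%g (act g x))
    (act g^-1%g (cinv (chart_at AM (act g x)) v)))).
- exact: act_differentiable.
- by rewrite cmapK//; exact: act_differentiable.
have h : \forall u \near chart_at AM x x,
    cdom (chart_at AM (act g x)) (act g (cinv (chart_at AM x) u)).
  apply: (cvg_comp _ _ (cinv_cvg qx) (act_continuous (x := x))).
  exact: near_cdom (mem_chart_at _ _).
apply: filterS2 h (near_cimg qx) => v qv pv.
by rewrite actK cmapK// actK cinvK.
Qed.

End ActionDifferentials.

Section SliceSmooth.
Context {R : realType} {V1 V2 W : normedModType R}.

Lemma is_diff_pairr (x : V1) (y : V2) :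
  is_diff y (fun y' => (x, y') : V1 * V2) (fun v => (0, v)).
Proof.
have dw : differentiable (fun y' : V2 => (x, y') : V1 * V2) y.
  exact: differentiable_pair.
apply: DiffDef => //; rewrite diff_pair//.
by apply/funext => v; rewrite diff_cst diff_val.
Qed.

(** The derivative of a slice along v is the derivative of f along (0, v), so the induction stays
    among slices. *)
Lemma Ck_slice k (U : set (V1 * V2)) (f : V1 * V2 -> W) x :
  open [set y | U (x, y)] ->
  Ck k U f -> Ck k [set y | U (x, y)] (fun y => f (x, y)).
Proof.
move=> oU; elim: k f => [|k IHk] f /=.
  move=> cf y Uxy.
  apply: (@continuous_comp _ _ _ (fun y => (x, y)) f); last exact: cf.
  by apply: differentiable_continuous; have [] := is_diff_pairr x y.
move=> [df ckf]; split=> [y Uxy|v].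
  have [dp _] := is_diff_pairr x y.
  exact: (differentiable_comp dp (df _ Uxy)).
apply: (@Ck_ext _ _ _ k _ (fun y => 'D_(0, v) f (x, y)) _ oU _
  (IHk _ (ckf (0, v)))) => y Uxy.
have [dp dpE] := is_diff_pairr x y.
have dc := differentiable_comp dp (df _ Uxy).
have dcE : 'd (f \o (fun y' : V2 => (x, y'))) y v = 'd f (x, y) (0, v).
  by rewrite (congr1 (@^~ v) (diff_comp dp (df _ Uxy))) /= dpE.
exact: etrans (deriveE (0, v) (df _ Uxy)) (esym (etrans (deriveE v dc) dcE)).
Qed.

End SliceSmooth.

(** Infinite x is covered: r > 0 keeps it infinite and [fine] sends both sides to 0. Volumes can
    thus be rescaled as reals with no finiteness argument. *)
Lemma fineZl {R : realType} (r : R) (x : \bar R) : 0 < r ->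
  fine (r%:E * x)%E = r * fine x.
Proof.
by move=> r0; case: x => [x||] //; rewrite ?gt0_muley ?gt0_muleNy ?lte_fin//= mulr0.
Qed.

(** * The metric in charts and linear invariance of the distortion *)

Section MetricFacts.
Context {R : realType} {n : nat} {M : topologicalType}.
Variables (A : smooth_manifold R n M) (F : M -> 'rV[R]_n -> R).
Hypothesis FF : finsler_metric A F.

(** In the selected chart at x the transition map is the identity near x; regularity of the local
    expression thus passes to the norm F x. *)
Lemma local_metric_chart_at x :
  local_metric A F (chart_at A x) (chart_at A x x) = F x.
Proof.
have qx := mem_chart_at A x; apply/funext => y.
rewrite /local_metric /chart_vector cmapK// diff_near_id//.
by apply: filterS (near_cimg qx) => u pu; rewrite cinvK.
Qed.

Lemma smooth_local_metric phi u : atlas A phi -> cimg phi u ->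
  smooth_on [set y | y != 0] (local_metric A F phi u).
Proof.
move=> aphi pu k; have /(@Ck_slice _ _ _ _ _ _ _ u) := finsler_smooth FF aphi k.
have -> : [set y : 'rV[R]_n | cimg phi (u, y).1 /\ (u, y).2 != 0] = [set y | y != 0].
  by apply/seteqP; split=> y /=; [case|split].
by apply; exact: open_neq0.
Qed.

Lemma finsler_smooth_fiber x : smooth_on [set y | y != 0] (F x).
Proof.
rewrite -local_metric_chart_at; apply: smooth_local_metric.
  exact: chart_at_atlas.
exact/cimg_cmap/mem_chart_at.
Qed.

Lemma finsler_continuous_fiber x : continuous (F x).
Proof.
rewrite -local_metric_chart_at => y.
set u := chart_at A x x.
apply: (@continuous_comp _ _ _ (fun y => (u, y))
  (fun w => local_metric A F (chart_at A x) w.1 w.2)).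
  by apply: differentiable_continuous; have [] := is_diff_pairr u y.
apply: (finsler_continuous FF (chart_at_atlas A x)).
exact/cimg_cmap/mem_chart_at.
Qed.

Lemma unitmx_mul_neq0 (J : 'M[R]_n) (y : 'rV[R]_n) :
  J \in unitmx -> y != 0 -> y *m J != 0.
Proof.
move=> uJ; apply: contra_neq => yJ.
by rewrite -(mulmxK uJ y) yJ mul0mx.
Qed.

(** In any chart the local norm is F composed with an invertible Jacobian, so strong convexity
    carries over. *)
Lemma local_metric_unit phi u y : atlas A phi -> cimg phi u -> y != 0 ->
  fundamental_matrix (local_metric A F phi u) y \in unitmx.
Proof.
move=> aphi pu y0; apply: fundamental_matrix_unit => // [|v v0].
  exact: smooth_local_metric.
have uJ := chart_vector_unit aphi pu; set J := jacobian _ _ in uJ.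
have -> : local_metric A F phi u = (fun w => F (cinv phi u) (w *m J)).
  by apply/funext => w; rewrite /local_metric chart_vectorE.
rewrite fundamental_form_comp; apply: (finsler_convex FF);
  exact: unitmx_mul_neq0.
Qed.

Lemma distortion_linear x x' (J : 'M[R]_n) y : J \in unitmx -> y != 0 ->
  (forall v, F x' (v *m J) = F x v) ->
  distortion F x' (y *m J) = distortion F x y.
Proof.
move=> uJ y0 FJ; rewrite /distortion /busemann_density.
have -> : F x = (fun v => F x' (v *m J)) by apply/funext => v; rewrite FJ.
rewrite fundamental_matrix_comp; last 2 first.
- exact: finsler_smooth_fiber.
- exact: unitmx_mul_neq0.
set B := [set v | F x' v < 1].
have mB : rV_measurable B.
  apply: rV_measurable_open; apply: open_comp (@open_lt R 1) => v _.
  exact: finsler_continuous_fiber.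
have := euclidean_volume_affine 0 uJ mB.
under eq_set do rewrite addr0; rewrite -/B => ->.
have d0 : 0 < `|\det J| by rewrite normr_gt0 -unitfE -unitmxE.
rewrite fineZl ?invr_gt0//.
set V := fine (euclidean_volume B); set Vb := fine _.
rewrite !det_mulmx det_tr mulrAC -expr2 sqrtrM ?sqr_ge0// sqrtr_sqr.
(* The volumes survive only as [V] and [Vb^-1], so |det J| is the only quantity to be cancelled and
   the only one that must be nonzero. *)
congr ln; rewrite !invfM !invrK; move: (Vb^-1) => w.
by field; rewrite gt_eqF.
Qed.

End MetricFacts.

(** * Geodesics *)

Section GeodesicUniqueness.
Context {R : realType}.

Lemma smooth_on_subset {V W : normedModType R} (U U' : set V) (f : V -> W) :
  U' `<=` U -> smooth_on U f -> smooth_on U' f.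
Proof.
move=> UU sf k; elim: k f {sf}(sf k) => [|k IHk] f /= => [cf x /UU|[df ckf]].
  exact: cf.
by split=> [x /UU|v]; [exact: df|exact: IHk].
Qed.

Context {n : nat} {M : topologicalType}.
Variables (A : smooth_manifold R n M) (F : M -> 'rV[R]_n -> R).
Hypothesis FF : finsler_metric A F.

(** The right-hand side of the geodesic equation solved for the second derivative. *)
Definition geodesic_spray (phi : chart R n M) (i : 'I_n)
    (w : 'rV[R]_n * 'rV[R]_n) : R :=
  - \sum_(j < n) \sum_(k < n)
      w.2 0 j * w.2 0 k * chern_coef (local_metric A F phi) i j k w.1 w.2.

Definition slit_domain (phi : chart R n M) : set ('rV[R]_n * 'rV[R]_n) :=
  [set w | cimg phi w.1 /\ w.2 != 0].

Lemma open_slit_domain phi : open (slit_domain phi).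
Proof.
have -> : slit_domain phi = (fst @^-1` cimg phi) `&` (snd @^-1` [set y | y != 0]).
  by [].
apply: openI; apply: open_comp => [w _|].
- exact: cvg_fst.
- exact: cimg_open.
- exact: cvg_snd.
- exact: open_neq0.
Qed.

Lemma smooth_geodesic_spray phi i : atlas A phi ->
  smooth_on (slit_domain phi) (geodesic_spray phi i).
Proof.
move=> aphi; have oU := open_slit_domain (phi := phi).
apply: smoothN => //; do 2 (apply: smooth_sum => // ? _).
apply: smoothM => //; first by apply: smoothM => //; exact: smooth2_coord.
apply: smooth2_chern_coef => //; first exact: finsler_smooth.
by move=> w [pw w0]; exact: local_metric_unit.
Qed.

Lemma geodesic_chart_ode (I : set R) c phi : atlas A phi ->
  geodesic A F I c -> (\forall t \near 0, I t) -> cdom phi (c 0) ->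
  let x := fun t : R => phi (c t) in
  [/\ \forall t \near (0 : R), cdom phi (c t),
      \forall t \near (0 : R),
        is_derive (t : R) 1 x (derive1 x t) /\
        is_derive (t : R) 1 (derive1 x) (derive1 (derive1 x) t) &
      \forall t \near (0 : R), forall i,
        derive1 (derive1 x) t 0 i = geodesic_spray phi i (x t, derive1 x t)].
Proof.
move=> aphi [[cc sc] geo] nI pc x.
have ncd : \forall t \near (0 : R), cdom phi (c t).
  exact: cc (nbhs_singleton nI) _ (near_cdom pc).
have xE : derive1 x = (fun t => 'D_1 x t).
  by apply/funext => t; rewrite derive1E.
split; first exact: ncd.
  apply: filterS2 nI ncd => t It pt; rewrite !derive1E.
  (* Order 2 of smoothness makes the first derivative of [x] differentiable. *)
  have [_ /(_ 1)] := sc phi aphi 2%N.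
  move=> [/(_ t (conj It pt)) d2 _].
  have d1 := smooth_differentiable (sc phi aphi)
    (conj It pt : (I `&` c @^-1` cdom phi) t).
  split; first exact/derivableP/diff_derivable.
  by apply/derivableP/diff_derivable; rewrite xE.
apply: filterS2 nI ncd => t It pt i.
have [_ /(_ phi aphi pt i)] := geo t It.
rewrite /covariant_acceleration /geodesic_spray /= => /eqP.
by rewrite addr_eq0 => /eqP.
Qed.

Lemma geodesic_unique (I1 I2 : set R) c1 c2 :
  geodesic A F I1 c1 -> geodesic A F I2 c2 ->
  (\forall t \near 0, I1 t) -> (\forall t \near 0, I2 t) ->
  c1 0 = c2 0 -> velocity A c1 0 = velocity A c2 0 ->
  \forall t \near (0 : R), c1 t = c2 t.
Proof.
(* [velocity] at time 0 is computed in this very chart, so the initial data match as they stand. *)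
move=> g1 g2 n1 n2 c12 v12; set phi := chart_at A (c1 0).
have aphi : atlas A phi := chart_at_atlas A (c1 0).
have pc1 : cdom phi (c1 0) := mem_chart_at A (c1 0).
have pc2 : cdom phi (c2 0) by rewrite -c12.
have [cd1 d1 e1] := geodesic_chart_ode aphi g1 n1 pc1.
have [cd2 d2 e2] := geodesic_chart_ode aphi g2 n2 pc2.
(* Part of being a geodesic; it places the initial data in the slit domain. *)
have v10 : velocity A c1 0 != 0 by have [_ /(_ 0 (nbhs_singleton n1))[]] := g1.
have := @second_order_unique R n (slit_domain phi) (geodesic_spray phi)
  _ _ _ _ _ _ (open_slit_domain (phi := phi))
  (fun i => smooth_geodesic_spray i aphi) _ _ _ d1 d2 e1 e2.
move=> H; apply: filterS2 (filterI cd1 cd2) (H _ _ _) => [t [p1 p2] x12||| ].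
- by rewrite -(cmapK p1) x12 cmapK.
- by split; [exact: cimg_cmap|exact: v10].
- by rewrite c12.
- by move: v12; rewrite /velocity -c12.
Qed.

End GeodesicUniqueness.

(** * Velocity and distortion along an orbit *)

Section DistortionAlongOrbit.
Context {R : realType} {n k : nat} {M : topologicalType} {G : topGroupType}.
Variables (AM : smooth_manifold R n M) (F : M -> 'rV[R]_n -> R).
Variables (AG : smooth_manifold R k G) (act : G -> M -> M).
Hypothesis FF : finsler_metric AM F.
Hypothesis sact : smooth_action AG AM act.
Hypothesis iact : isometric_action AM F act.

Lemma distortion_act g x y : y != 0 ->
  distortion F (act g x) (tangent_map AM AM (act g) x y) = distortion F x y.
Proof.
move=> y0; rewrite tangent_actE.
apply: (distortion_linear FF _ y0); first exact: act_jacobian_unit sact g x.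
by move=> v; rewrite -(iact g x v) tangent_actE.
Qed.

Lemma velocity_act g (c : R -> M) t : {for t, continuous c} ->
  differentiable (fun s : R => chart_at AM (c t) (c s)) t ->
  velocity AM (fun s => act g (c s)) t =
  tangent_map AM AM (act g) (c t) (velocity AM c t).
Proof.
by move=> cc dc; apply: velocity_map => //; exact: (act_differentiable sact).
Qed.

Lemma orbit_velocity X gamma p : exp_curve AG X gamma ->
  velocity AM (fun t => act (gamma t) p) 0 = orbit_differential AG AM act p X.
Proof.
move=> [sg g0 _ vX].
rewrite (@velocity_map _ _ _ _ _ AG AM (fun g => act g p) gamma).
- by rewrite vX g0.
- by case: sg => cg _; exact: cg.
- exact: (smooth_curve_differentiable _ sg).
- exact: (orbit_differentiable sact).
Qed.

End DistortionAlongOrbit.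

Section OrbitDifferential.
Context {R : realType} {n k : nat} {M : topologicalType} {G : topGroupType}.
Variables (AM : smooth_manifold R n M) (AG : smooth_manifold R k G).
Variables (act : G -> M -> M) (p : M).
Hypothesis sact : smooth_action AG AM act.

Lemma orbit_differential_isotropy (h : {vspace 'rV[R]_k}) Z :
  lie_algebra_of AG (isotropy act p) h -> Z \in h ->
  orbit_differential AG AM act p Z = 0.
Proof.
move=> hh /hh[gamma expZ fixp].
rewrite -(orbit_velocity sact p expZ).
rewrite (@near_eq_velocity _ _ _ _ _ (fun=> p)).
  by rewrite /velocity derive1_cst.
by near=> t; exact: fixp.
Unshelve. all: by end_near. Qed.

Lemma orbit_differential_proj (m h : {vspace 'rV[R]_k}) X :
  lie_algebra_of AG (isotropy act p) h ->
  reductive_decomposition AG (isotropy act p) m h ->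
  orbit_differential AG AM act p (daddv_pi m h X) =
  orbit_differential AG AM act p X.
Proof.
move=> hh [mhT mh0 _].
have Xmh : X \in (m + h)%VS by rewrite mhT memvf.
rewrite -[in RHS](daddv_pi_add mh0 Xmh) /orbit_differential /tangent_map linearD.
have := orbit_differential_isotropy hh (memv_pi h m X).
by rewrite /orbit_differential /tangent_map => ->; rewrite addr0.
Qed.

End OrbitDifferential.

Theorem theorem5p1 (R : realType) (n k : nat)
  (M : topologicalType) (AM : smooth_manifold R n M) (F : M -> 'rV[R]_n -> R)
  (G : topGroupType) (AG : smooth_manifold R k G) (act : G -> M -> M)
  (p : M) (m h : {vspace 'rV[R]_k}) (X : 'rV[R]_k) :
  connected [set: M] ->
  finsler_metric AM F ->
  lie_group AG ->
  connected [set: G] ->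
  smooth_action AG AM act ->
  isometric_action AM F act ->
  transitive_action act ->
  lie_algebra_of AG (isotropy act p) h ->
  reductive_decomposition AG (isotropy act p) m h ->
  geodesic_vector AG AM F act p X ->
  daddv_pi m h X != 0 ->
  S_curvature_is AM F p (orbit_differential AG AM act p (daddv_pi m h X)) 0.
Proof.
move=> _ FF _ _ sact iact _ hh red [_ [gamma expX geo]] _.
rewrite (orbit_differential_proj sact _ hh red).
pose c t := act (gamma t) p.
have [sg g0 gD vX] := expX.
have c0 : c 0 = p by rewrite /c g0 (act1 sact).
have vc : velocity AM c 0 = orbit_differential AG AM act p X.
  exact: (orbit_velocity sact p expX).
have [[cc _] gc] := geo.
have y0 : velocity AM c 0 != 0 by have [] := gc 0 I.
have dist_c t : distortion F (c t) (velocity AM c t) =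
    distortion F p (velocity AM c 0).
  rewrite -(distortion_act FF sact iact (gamma t) p y0) -[in RHS]c0.
  rewrite -(velocity_act sact); last 2 first.
  - exact: cc.
  - exact: (smooth_curve_differentiable I (proj1 geo)).
  rewrite c0; congr (distortion F _ _).
  (* Since gamma(t + s) = gamma(t) gamma(s), the curve [c] shifted by t is the image of [c] under
     gamma(t). *)
  rewrite -velocity_shift; congr (velocity AM _ 0); apply/funext => s.
  by rewrite /c gD (actM sact).
split.
  exists c; split; [|exact: c0|exact: vc].
  (* [c] is a geodesic on the whole line, so any radius would do. *)
  exists 1; first exact: ltr01.
  split; last by move=> t _; exact: gc.
  split=> [t _|phi aphi]; first exact: cc.
  by apply: smooth_on_subset (proj2 (proj1 geo) phi aphi) => t [_].
move=> c2 [[e e0 geo2] c20 vc2].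
have n2 : \forall t \near (0 : R), `]- e, e[%classic t.
  by apply: near0I e0 _ => t te; rewrite /= in_itv/= -ltr_norml.
have cc2 : \forall t \near (0 : R), c t = c2 t.
  apply: (geodesic_unique FF geo geo2).
  - exact: (@filterT _ (nbhs (0 : R)) _).
  - exact: n2.
  - by rewrite c20.
  - by rewrite vc2.
apply: (@near_eq_is_derive _ _ _ (fun=> distortion F p (velocity AM c 0))).
  (* The velocity at t depends on the curve around t, so the two curves must agree on a
     neighbourhood of each t near 0. *)
  apply: filterS (nbhs_interior cc2) => t cc2t; rewrite -(dist_c t).
  by rewrite (nbhs_singleton cc2t) (near_eq_velocity AM cc2t).
Qed.
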